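(* Let $A$ be a finitely generated compact abelian Lie group and $m$ a positive integer. The internal equivalence classes of pseudofunctors $F:BBA\to\mathsf{s2Vect}_k$ with $F( * )=k^{\oplus m}$ are in bijection with $\hom_{\mathrm{grp}}(A,(k^{*})^{\oplus m})/\Sigma_m$.
   Context: $k$ is a field of characteristic zero (typically $\mathbb{R}$ or $\mathbb{C}$), $k^*$ its multiplicative group. $\mathsf{s2Vect}_k$ is the bicategory of finite-dimensional super algebras over $k$ ($\mathbb{Z}/2$-graded, unital, associative); 1-morphisms $\mathcal{A}\to\mathcal{B}$ are $\mathbb{Z}/2$-graded finitely generated $\mathcal{B}$-$\mathcal{A}$-bimodules composed by relative tensor product; 2-morphisms are parity-preserving intertwiners. $k^{\oplus m}$ is the $m$-fold direct sum of the super algebra $k$. $BBA$ is the delooping of the strict 2-group $BA$ (one object, morphisms $A$): it is the bicategory with one object $*$, one 1-morphism $\mathrm{id}_*$, and 2-morphisms the elements of $A$, both compositions being addition. Pseudofunctors $BBA\to\mathsf{s2Vect}_k$, strong transformations and modifications form the bicategory $2\mathrm{Rep}(BA)$; internal equivalence means equivalence in this bicategory. By the paper's convention all pseudofunctors, hence the homomorphisms out of $A$, are smooth. The symmetric group $\Sigma_m$ acts on $\hom_{\mathrm{grp}}(A,(k^* )^{\oplus m})$ by permuting the $m$ components. *)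

(* Defs.v *)
From HB Require Import structures.
From mathcomp Require Import all_boot all_order all_algebra.
From mathcomp Require Import perm generic_quotient complex.
From mathcomp Require Import all_classical all_reals all_analysis.

Set Implicit Arguments.
Unset Strict Implicit.
Unset Printing Implicit Defensive.

Import Order.TTheory GRing.Theory Num.Theory.
Import numFieldNormedType.Exports.

Local Open Scope ring_scope.

(* [comp1 g f] is "f, then g"; likewise [vcomp] and [hcomp]. *)
Record bicategory := Bicategory {
  ob :> Type;
  hom : ob -> ob -> Type;
  cell : forall a b : ob, hom a b -> hom a b -> Type;
  id1 : forall a, hom a a;
  comp1 : forall a b c, hom b c -> hom a b -> hom a c;
  id2 : forall a b (f : hom a b), cell f f;
  vcomp : forall a b (f g h : hom a b), cell g h -> cell f g -> cell f h;
  hcomp : forall a b c (g g' : hom b c) (f f' : hom a b),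
    cell g g' -> cell f f' -> cell (comp1 g f) (comp1 g' f');
  assoc : forall a b c d (h : hom c d) (g : hom b c) (f : hom a b),
    cell (comp1 (comp1 h g) f) (comp1 h (comp1 g f));
  assocV : forall a b c d (h : hom c d) (g : hom b c) (f : hom a b),
    cell (comp1 h (comp1 g f)) (comp1 (comp1 h g) f);
  lun : forall a b (f : hom a b), cell (comp1 (id1 b) f) f;
  lunV : forall a b (f : hom a b), cell f (comp1 (id1 b) f);
  run : forall a b (f : hom a b), cell (comp1 f (id1 a)) f;
  runV : forall a b (f : hom a b), cell f (comp1 f (id1 a));
  vcompA : forall a b (f g h i : hom a b)
    (x : cell h i) (y : cell g h) (z : cell f g),
    vcomp x (vcomp y z) = vcomp (vcomp x y) z;
  vcomp1l : forall a b (f g : hom a b) (x : cell f g), vcomp (id2 g) x = x;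
  vcomp1r : forall a b (f g : hom a b) (x : cell f g), vcomp x (id2 f) = x;
  hcomp_id2 : forall a b c (g : hom b c) (f : hom a b),
    hcomp (id2 g) (id2 f) = id2 (comp1 g f);
  interchange : forall a b c (g g' g'' : hom b c) (f f' f'' : hom a b)
    (y' : cell g' g'') (y : cell g g') (x' : cell f' f'') (x : cell f f'),
    hcomp (vcomp y' y) (vcomp x' x) = vcomp (hcomp y' x') (hcomp y x);
  assocK : forall a b c d (h : hom c d) (g : hom b c) (f : hom a b),
    vcomp (assocV h g f) (assoc h g f) = id2 _;
  assocVK : forall a b c d (h : hom c d) (g : hom b c) (f : hom a b),
    vcomp (assoc h g f) (assocV h g f) = id2 _;
  lunK : forall a b (f : hom a b), vcomp (lunV f) (lun f) = id2 _;
  lunVK : forall a b (f : hom a b), vcomp (lun f) (lunV f) = id2 _;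
  runK : forall a b (f : hom a b), vcomp (runV f) (run f) = id2 _;
  runVK : forall a b (f : hom a b), vcomp (run f) (runV f) = id2 _;
  assoc_nat : forall a b c d (h h' : hom c d) (g g' : hom b c) (f f' : hom a b)
    (z : cell h h') (y : cell g g') (x : cell f f'),
    vcomp (assoc h' g' f') (hcomp (hcomp z y) x)
    = vcomp (hcomp z (hcomp y x)) (assoc h g f);
  lun_nat : forall a b (f f' : hom a b) (x : cell f f'),
    vcomp (lun f') (hcomp (id2 (id1 b)) x) = vcomp x (lun f);
  run_nat : forall a b (f f' : hom a b) (x : cell f f'),
    vcomp (run f') (hcomp x (id2 (id1 a))) = vcomp x (run f);
  triangle : forall a b c (g : hom b c) (f : hom a b),
    vcomp (hcomp (id2 g) (lun f)) (assoc g (id1 b) f) = hcomp (run g) (id2 f);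
  pentagon : forall a b c d e
    (i : hom d e) (h : hom c d) (g : hom b c) (f : hom a b),
    vcomp (assoc i h (comp1 g f)) (assoc (comp1 i h) g f)
    = vcomp (hcomp (id2 i) (assoc h g f))
        (vcomp (assoc i (comp1 h g) f) (hcomp (assoc i h g) (id2 f)))
}.

Declare Scope bicat_scope.
Delimit Scope bicat_scope with bicat.
Notation "g \o1 f" := (comp1 g f)
  (at level 40, left associativity) : bicat_scope.
Notation "y \v x" := (vcomp y x)
  (at level 50, left associativity) : bicat_scope.
Notation "y \h x" := (hcomp y x)
  (at level 40, left associativity) : bicat_scope.
Notation "''1' f" := (id2 f) (at level 8, f at level 8) : bicat_scope.

Section Bicategory.
Local Open Scope bicat_scope.

Definition invertible2 (C : bicategory) (a b : C) (f g : hom a b)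
    (x : cell f g) : Prop :=
  exists y : cell g f, y \v x = '1 f /\ x \v y = '1 g.

Record pseudofunctor (B C : bicategory) := Pseudofunctor {
  pf0 :> B -> C;
  pf1 : forall a b : B, hom a b -> hom (pf0 a) (pf0 b);
  pf2 : forall (a b : B) (f g : hom a b), cell f g -> cell (pf1 f) (pf1 g);
  pf_unit : forall a : B, cell (id1 (pf0 a)) (pf1 (id1 a));
  pf_comp : forall (a b c : B) (g : hom b c) (f : hom a b),
    cell (pf1 g \o1 pf1 f) (pf1 (g \o1 f));
  pf_unit_inv : forall a : B, invertible2 (pf_unit a);
  pf_comp_inv : forall (a b c : B) (g : hom b c) (f : hom a b),
    invertible2 (pf_comp g f);
  pf_id2 : forall (a b : B) (f : hom a b), pf2 ('1 f) = '1 (pf1 f);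
  pf_vcomp : forall (a b : B) (f g h : hom a b) (y : cell g h) (x : cell f g),
    pf2 (y \v x) = pf2 y \v pf2 x;
  pf_comp_nat : forall (a b c : B) (g g' : hom b c) (f f' : hom a b)
    (y : cell g g') (x : cell f f'),
    pf_comp g' f' \v (pf2 y \h pf2 x) = pf2 (y \h x) \v pf_comp g f;
  pf_assoc : forall (a b c d : B) (h : hom c d) (g : hom b c) (f : hom a b),
    pf2 (assoc h g f) \v pf_comp (h \o1 g) f \v (pf_comp h g \h '1 (pf1 f))
    = pf_comp h (g \o1 f) \v ('1 (pf1 h) \h pf_comp g f)
      \v assoc (pf1 h) (pf1 g) (pf1 f);
  pf_lun : forall (a b : B) (f : hom a b),
    pf2 (lun f) \v pf_comp (id1 b) f \v (pf_unit b \h '1 (pf1 f))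
    = lun (pf1 f);
  pf_run : forall (a b : B) (f : hom a b),
    pf2 (run f) \v pf_comp f (id1 a) \v ('1 (pf1 f) \h pf_unit a)
    = run (pf1 f)
}.

(* The 2-cells [tr1 f] point from [G f \o1 tr0 a] to [tr0 b \o1 F f]; the laws
   of a strong transformation are in [is_strong]. *)
Record trans_data (B C : bicategory) (F G : pseudofunctor B C) := TransData {
  tr0 : forall a : B, hom (F a) (G a);
  tr1 : forall (a b : B) (f : hom a b),
    cell (pf1 G f \o1 tr0 a) (tr0 b \o1 pf1 F f)
}.

Record is_strong (B C : bicategory) (F G : pseudofunctor B C)
    (s : trans_data F G) : Prop := IsStrong {
  tr_inv : forall (a b : B) (f : hom a b), invertible2 (tr1 s f);
  tr_nat : forall (a b : B) (f f' : hom a b) (x : cell f f'),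
    tr1 s f' \v (pf2 G x \h '1 (tr0 s a))
    = ('1 (tr0 s b) \h pf2 F x) \v tr1 s f;
  tr_unit : forall a : B,
    tr1 s (id1 a) \v (pf_unit G a \h '1 (tr0 s a))
    = ('1 (tr0 s a) \h pf_unit F a) \v runV (tr0 s a) \v lun (tr0 s a);
  tr_comp : forall (a b c : B) (g : hom b c) (f : hom a b),
    tr1 s (g \o1 f) \v (pf_comp G g f \h '1 (tr0 s a))
    = ('1 (tr0 s c) \h pf_comp F g f) \v assoc (tr0 s c) (pf1 F g) (pf1 F f)
      \v (tr1 s g \h '1 (pf1 F f)) \v assocV (pf1 G g) (tr0 s b) (pf1 F f)
      \v ('1 (pf1 G g) \h tr1 s f) \v assoc (pf1 G g) (pf1 G f) (tr0 s a)
}.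

Definition id_trans (B C : bicategory) (F : pseudofunctor B C) :
    trans_data F F :=
  @TransData B C F F (fun a => id1 (F a))
    (fun a b f => lunV (pf1 F f) \v run (pf1 F f)).

Definition comp_trans (B C : bicategory) (F G H : pseudofunctor B C)
    (t : trans_data G H) (s : trans_data F G) : trans_data F H :=
  @TransData B C F H (fun a => tr0 t a \o1 tr0 s a)
    (fun a b f =>
      assocV (tr0 t b) (tr0 s b) (pf1 F f) \v ('1 (tr0 t b) \h tr1 s f)
      \v assoc (tr0 t b) (pf1 G f) (tr0 s a) \v (tr1 t f \h '1 (tr0 s a))
      \v assocV (pf1 H f) (tr0 t a) (tr0 s a)).

Record modification (B C : bicategory) (F G : pseudofunctor B C)
    (s t : trans_data F G) := Modification {
  md0 : forall a : B, cell (tr0 s a) (tr0 t a);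
  md_nat : forall (a b : B) (f : hom a b),
    tr1 t f \v ('1 (pf1 G f) \h md0 a) = (md0 b \h '1 (pf1 F f)) \v tr1 s f
}.

(* A modification is invertible iff its components are: the componentwise
   inverses automatically form a modification. *)
Definition iso_trans (B C : bicategory) (F G : pseudofunctor B C)
    (s t : trans_data F G) : Prop :=
  exists m : modification s t, forall a : B, invertible2 (md0 m a).

Definition internal_equivalence (B C : bicategory) (F G : pseudofunctor B C) :
    Prop :=
  exists (s : trans_data F G) (t : trans_data G F),
    [/\ is_strong s, is_strong t,
        iso_trans (comp_trans t s) (id_trans F)
      & iso_trans (comp_trans s t) (id_trans G)].

End Bicategory.

Section BBA.
Variable A : zmodType.

Definition BBA : bicategory.
Proof.
refine (@Bicategory unit (fun _ _ => unit) (fun _ _ _ _ => A)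
  (fun _ => tt) (fun _ _ _ _ _ => tt) (fun _ _ _ => 0)
  (fun _ _ _ _ _ y x => y + x) (fun _ _ _ _ _ _ _ y x => y + x)
  (fun _ _ _ _ _ _ _ => 0) (fun _ _ _ _ _ _ _ => 0)
  (fun _ _ _ => 0) (fun _ _ _ => 0) (fun _ _ _ => 0) (fun _ _ _ => 0)
  _ _ _ _ _ _ _ _ _ _ _ _ _ _ _ _); move=> *; rewrite ?add0r ?addr0 //.
- exact: addrA.
- exact: addrACA.
- by rewrite -addrA.
Defined.

End BBA.

Section Super.
Variable k : fieldType.

(* A Z/2-grading V = V_0 (+) V_1, given by its homogeneous projections; degrees
   are booleans and add by [addb]. *)
Record grading (V : lmodType k) := Grading {
  part :> bool -> V -> V;
  part_linear : forall p, linear (part p);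
  part_sum : forall v, part false v + part true v = v;
  part_part : forall p q v, part p (part q v) = if p == q then part q v else 0
}.

Definition homog (V : lmodType k) (g : grading V) (p : bool) (v : V) : Prop :=
  g p v = v.

(* [algType] would exclude the zero algebra. *)
Record superalg := SuperAlg {
  sa_sort :> vectType k;
  sa_gr : grading sa_sort;
  sa_one : sa_sort;
  sa_mul : sa_sort -> sa_sort -> sa_sort;
  sa_mulA : associative sa_mul;
  sa_mul1l : left_id sa_one sa_mul;
  sa_mul1r : right_id sa_one sa_mul;
  sa_mull : forall b, linear (sa_mul^~ b);
  sa_mulr : forall a, linear (sa_mul a);
  sa_one_homog : homog sa_gr false sa_one;
  sa_mul_homog : forall p q a b,
    homog sa_gr p a -> homog sa_gr q b -> homog sa_gr (p (+) q) (sa_mul a b)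
}.

(* A [bimod B A] is a 1-morphism from A to B. *)
Record bimod (B A : superalg) := Bimod {
  bm_sort :> lmodType k;
  bm_gr : grading bm_sort;
  lact : B -> bm_sort -> bm_sort;
  ract : bm_sort -> A -> bm_sort;
  lact_linl : forall m, linear (lact^~ m);
  lact_linr : forall b, linear (lact b);
  lact1 : forall m, lact (sa_one B) m = m;
  lactM : forall b b' m, lact (sa_mul b b') m = lact b (lact b' m);
  ract_linl : forall a, linear (ract^~ a);
  ract_linr : forall m, linear (ract m);
  ract1 : forall m, ract m (sa_one A) = m;
  ractM : forall a a' m, ract m (sa_mul a a') = ract (ract m a) a';
  lractA : forall b m a, ract (lact b m) a = lact b (ract m a);
  lact_homog : forall p q b m,
    homog (sa_gr B) p b -> homog bm_gr q m -> homog bm_gr (p (+) q) (lact b m);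
  ract_homog : forall p q m a,
    homog bm_gr p m -> homog (sa_gr A) q a -> homog bm_gr (p (+) q) (ract m a);
  bm_fg : exists (I : finType) (g : I -> bm_sort), forall m : bm_sort,
    exists s : seq (B * I * A), m = \sum_(x <- s) ract (lact x.1.1 (g x.1.2)) x.2
}.

Record intertwiner (B A : superalg) (M N : bimod B A) := Intertwiner {
  iw_fun :> M -> N;
  iw_linear : linear iw_fun;
  iw_lact : forall b m, iw_fun (lact b m) = lact b (iw_fun m);
  iw_ract : forall m a, iw_fun (ract m a) = ract (iw_fun m) a;
  iw_even : forall p m, homog (bm_gr M) p m -> homog (bm_gr N) p (iw_fun m)
}.

Lemma iw_ext (B A : superalg) (M N : bimod B A) (f g : intertwiner M N) :
  f =1 g -> f = g.
Proof.
case: f g => [f f1 f2 f3 f4] [g g1 g2 g3 g4] /= /funext efg.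
by subst g; congr Intertwiner; exact: Prop_irrelevance.
Qed.

Section Gradings.
Variables (V : lmodType k) (g : grading V).

Lemma partD p : {morph g p : x y / x + y}.
Proof. by move=> x y; have := part_linear g p 1 x y; rewrite !scale1r. Qed.

Lemma part0 p : g p 0 = 0.
Proof. by apply: (addrI (g p 0)); rewrite -partD !addr0. Qed.

Lemma partZ p c x : g p (c *: x) = c *: g p x.
Proof. by have := part_linear g p c x 0; rewrite part0 !addr0. Qed.

Lemma part_homog p v : homog g p (g p v).
Proof. by rewrite /homog part_part eqxx. Qed.

Lemma homog_part p q v : homog g p v -> g q v = if q == p then v else 0.
Proof. by move=> h; rewrite -h part_part h. Qed.

Lemma part_split p v : v = g p v + g (~~ p) v.
Proof. by case: p => /=; rewrite ?[g true v + _]addrC part_sum. Qed.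

End Gradings.

Lemma linD (U V : lmodType k) (f : U -> V) : linear f -> {morph f : x y / x + y}.
Proof. by move=> h x y; have := h 1 x y; rewrite !scale1r. Qed.

Lemma lin0 (U V : lmodType k) (f : U -> V) : linear f -> f 0 = 0.
Proof. by move=> h; apply: (addrI (f 0)); rewrite -(linD h) !addr0. Qed.

Lemma linZ (U V : lmodType k) (f : U -> V) c x :
  linear f -> f (c *: x) = c *: f x.
Proof. by move=> h; have := h c x 0; rewrite (lin0 h) !addr0. Qed.

Lemma linN (U V : lmodType k) (f : U -> V) x : linear f -> f (- x) = - f x.
Proof. by move=> h; rewrite -scaleN1r linZ // scaleN1r. Qed.

Lemma lin_sum (U V : lmodType k) (f : U -> V) I (s : seq I) (F : I -> U) :
  linear f -> f (\sum_(i <- s) F i) = \sum_(i <- s) f (F i).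
Proof. by move=> h; exact: (big_morph f (linD h) (lin0 h)). Qed.

Lemma iw_part (B A : superalg) (M N : bimod B A) (f : intertwiner M N) p m :
  bm_gr N p (f m) = f (bm_gr M p m).
Proof.
rewrite {1}(part_split (bm_gr M) p m) (linD (iw_linear f)) partD.
have h q : homog (bm_gr N) q (f (bm_gr M q m)).
  by apply: iw_even; exact: part_homog.
by rewrite !(homog_part _ (h _)) eqxx; case: p; rewrite addr0.
Qed.

Section PartAct.
Variables (B A : superalg) (M : bimod B A).

Lemma part_lact p b m : bm_gr M p (lact b m)
  = lact (sa_gr B false b) (bm_gr M p m)
    + lact (sa_gr B true b) (bm_gr M (~~ p) m).
Proof.
have h q r : homog (bm_gr M) (q (+) r) (lact (sa_gr B q b) (bm_gr M r m)).
  by apply: lact_homog; exact: part_homog.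
rewrite -{1}(part_sum (sa_gr B) b) (linD (lact_linl _)).
rewrite {1 2}(part_split (bm_gr M) p m) !(linD (lact_linr _)) !partD.
rewrite !(homog_part _ (h _ _)).
by case: p => /=; rewrite ?addr0 ?add0r.
Qed.

Lemma part_ract p m a : bm_gr M p (ract m a)
  = ract (bm_gr M p m) (sa_gr A false a)
    + ract (bm_gr M (~~ p) m) (sa_gr A true a).
Proof.
have h q r : homog (bm_gr M) (r (+) q) (ract (bm_gr M r m) (sa_gr A q a)).
  by apply: ract_homog; exact: part_homog.
rewrite -{1}(part_sum (sa_gr A) a) (linD (ract_linr _)).
rewrite {1 2}(part_split (bm_gr M) p m) !(linD (ract_linl _)) !partD.
rewrite !(homog_part _ (h _ _)).
by case: p => /=; rewrite ?addr0 ?add0r.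
Qed.

End PartAct.

Section TensorType.
Variables (A B C : superalg) (N : bimod C B) (M : bimod B A).

(* Formal sums of pure tensors are sequences of pairs; no generator for k is
   needed, since k acts on both factors through B. *)
Inductive tensor_rel : seq (N * M) -> seq (N * M) -> Prop :=
| trel_refl s : tensor_rel s s
| trel_sym s s' : tensor_rel s s' -> tensor_rel s' s
| trel_trans s s' s'' :
    tensor_rel s s' -> tensor_rel s' s'' -> tensor_rel s s''
| trel_cat s1 s1' s2 s2' :
    tensor_rel s1 s1' -> tensor_rel s2 s2' -> tensor_rel (s1 ++ s2) (s1' ++ s2')
| trel_comm s1 s2 : tensor_rel (s1 ++ s2) (s2 ++ s1)
| trel_zero m : tensor_rel [:: (0, m)] [::]
| trel_addl n n' m : tensor_rel [:: (n + n', m)] [:: (n, m); (n', m)]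
| trel_addr n m m' : tensor_rel [:: (n, m + m')] [:: (n, m); (n, m')]
| trel_bal n b m : tensor_rel [:: (ract n b, m)] [:: (n, lact b m)].

Definition tensor_eqv (s s' : seq (N * M)) : bool := `[< tensor_rel s s' >].

Lemma tensor_eqv_refl : reflexive tensor_eqv.
Proof. by move=> s; apply/asboolP; exact: trel_refl. Qed.

Lemma tensor_eqv_sym : symmetric tensor_eqv.
Proof. by move=> s s'; apply/asboolP/asboolP; exact: trel_sym. Qed.

Lemma tensor_eqv_trans : transitive tensor_eqv.
Proof. by move=> s s' s'' /asboolP h /asboolP h'; apply/asboolP/(trel_trans h). Qed.

Canonical tensor_equiv :=
  EquivRel tensor_eqv tensor_eqv_refl tensor_eqv_sym tensor_eqv_trans.

Definition tensor : Type := {eq_quot tensor_equiv}%qT.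

HB.instance Definition _ := Choice.on tensor.

Definition tclass (s : seq (N * M)) : tensor := \pi_({eq_quot tensor_equiv})%qT s.
Definition trepr (t : tensor) : seq (N * M) := repr (t : {eq_quot tensor_equiv}%qT).

Lemma treprK t : tclass (trepr t) = t.
Proof. exact: reprK. Qed.

Lemma tclassP s s' : tclass s = tclass s' <-> tensor_rel s s'.
Proof.
split=> [h|h]; first by have /eqmodP/asboolP := h.
by apply/eqmodP/asboolP.
Qed.

Lemma trepr_class s : tensor_rel (trepr (tclass s)) s.
Proof. by apply/tclassP; rewrite treprK. Qed.

Definition tadd (s t : tensor) : tensor := tclass (trepr s ++ trepr t).
Definition tneg (s : seq (N * M)) := [seq (- x.1, x.2) | x <- s].
Definition topp (t : tensor) : tensor := tclass (tneg (trepr t)).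

Lemma tadd_class s t : tadd (tclass s) (tclass t) = tclass (s ++ t).
Proof. by apply/tclassP/trel_cat; exact: trepr_class. Qed.

Lemma tensor_rel_neg s : tensor_rel (tneg s ++ s) [::].
Proof.
elim: s => [|[n m] s ih]; first exact: trel_refl.
apply: (@trel_trans _ ([:: (- n, m); (n, m)] ++ (tneg s ++ s))).
  refine (@trel_cat [:: (- n, m)] [:: (- n, m)] (tneg s ++ [:: (n, m)] ++ s)
                    ([:: (n, m)] ++ tneg s ++ s) _ _); first exact: trel_refl.
  by rewrite !catA; apply: trel_cat; [exact: trel_comm | exact: trel_refl].
rewrite -[X in tensor_rel _ X]cats0; apply: trel_cat ih.
apply: trel_trans (trel_sym (trel_addl _ _ _)) _.
by rewrite addNr; exact: trel_zero.
Qed.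

Lemma taddA : associative tadd.
Proof.
move=> x y z; rewrite -(treprK x) -(treprK y) -(treprK z).
by rewrite !tadd_class catA.
Qed.

Lemma taddC : commutative tadd.
Proof. by move=> x y; apply/tclassP; exact: trel_comm. Qed.

Lemma tadd0 : left_id (tclass [::]) tadd.
Proof. by move=> x; rewrite -(treprK x) tadd_class. Qed.

Lemma taddN : left_inverse (tclass [::]) topp tadd.
Proof.
move=> x; rewrite -{2}(treprK x) tadd_class.
by apply/tclassP; exact: tensor_rel_neg.
Qed.

HB.instance Definition _ := GRing.isZmodule.Build tensor taddA taddC tadd0 taddN.

Definition pure (n : N) (m : M) : tensor := tclass [:: (n, m)].

Lemma tclassE s : tclass s = \sum_(x <- s) pure x.1 x.2.
Proof.
elim: s => [|[n m] s ih]; first by rewrite big_nil.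
by rewrite big_cons /= -ih [RHS]tadd_class.
Qed.

Lemma pureDl n n' m : pure (n + n') m = pure n m + pure n' m.
Proof. rewrite [RHS]tadd_class; apply/tclassP; exact: trel_addl. Qed.

Lemma pureDr n m m' : pure n (m + m') = pure n m + pure n m'.
Proof. rewrite [RHS]tadd_class; apply/tclassP; exact: trel_addr. Qed.

Lemma pure_bal n b m : pure (ract n b) m = pure n (lact b m).
Proof. by apply/tclassP; exact: trel_bal. Qed.

Lemma pure0l m : pure 0 m = 0.
Proof. by apply: (addrI (pure 0 m)); rewrite -pureDl !addr0. Qed.

Lemma pure0r n : pure n 0 = 0.
Proof. by apply: (addrI (pure n 0)); rewrite -pureDr !addr0. Qed.

Lemma tensor_ind (P : tensor -> Prop) :
  P 0 -> (forall x y, P x -> P y -> P (x + y)) -> (forall n m, P (pure n m)) ->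
  forall t, P t.
Proof.
move=> P0 PD Pp t; rewrite -(treprK t) tclassE.
by elim/big_ind: _ => // x _; exact: Pp.
Qed.

Lemma tensor_ext (W : zmodType) (f g : tensor -> W) :
  {morph f : x y / x + y} -> {morph g : x y / x + y} ->
  (forall n m, f (pure n m) = g (pure n m)) -> f =1 g.
Proof.
move=> fD gD fg; apply: tensor_ind => // [|x y ex ey].
  have f0 : f 0 = 0 by apply: (addrI (f 0)); rewrite -fD !addr0.
  have g0 : g 0 = 0 by apply: (addrI (g 0)); rewrite -gD !addr0.
  by rewrite f0 g0.
by rewrite fD gD ex ey.
Qed.

Section Lift.
Variables (W : zmodType) (f : N -> M -> W).

Definition tlift (t : tensor) : W := \sum_(x <- trepr t) f x.1 x.2.

Record balanced : Prop := Balanced {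
  bal_addl : forall n n' m, f (n + n') m = f n m + f n' m;
  bal_addr : forall n m m', f n (m + m') = f n m + f n m';
  bal_bal : forall n b m, f (ract n b) m = f n (lact b m)
}.

Hypothesis fbal : balanced.

Lemma tlift_rel s s' : tensor_rel s s' ->
  \sum_(x <- s) f x.1 x.2 = \sum_(x <- s') f x.1 x.2.
Proof.
elim=> {s s'} [//|//|s s' s'' _ -> _ -> //|s1 s1' s2 s2' _ e1 _ e2|s1 s2|m
  |n n' m|n m m'|n b m]; rewrite ?big_cat ?big_cons ?big_nil /= ?addr0.
- by rewrite e1 e2.
- by rewrite addrC.
- by apply: (addrI (f 0 m)); rewrite -(bal_addl fbal) !addr0.
- exact: bal_addl.
- exact: bal_addr.
- exact: bal_bal.
Qed.

Lemma tlift_class s : tlift (tclass s) = \sum_(x <- s) f x.1 x.2.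
Proof. by apply: tlift_rel; exact: trepr_class. Qed.

Lemma tlift_pure n m : tlift (pure n m) = f n m.
Proof. by rewrite tlift_class big_seq1. Qed.

Lemma tliftD : {morph tlift : x y / x + y}.
Proof.
move=> x y; rewrite -(treprK x) -(treprK y) [_ + _]tadd_class.
by rewrite !tlift_class big_cat.
Qed.

End Lift.

Lemma scale_ract (n : N) c : c *: n = ract n (c *: sa_one B).
Proof. by rewrite (linZ _ _ (ract_linr _)) ract1. Qed.

Lemma scale_lact (m : M) c : c *: m = lact (c *: sa_one B) m.
Proof. by rewrite (linZ _ _ (lact_linl _)) lact1. Qed.

Lemma pureZr c n m : pure (c *: n) m = pure n (c *: m).
Proof. by rewrite scale_ract pure_bal -scale_lact. Qed.

Definition tscale (c : k) : tensor -> tensor := tlift (fun n m => pure (c *: n) m).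

Lemma tscale_bal c : balanced (fun n m => pure (c *: n) m).
Proof.
split=> *; rewrite ?scalerDr ?pureDl ?pureDr //.
by rewrite -(linZ _ _ (ract_linl _)) pure_bal.
Qed.

Lemma tscaleE c n m : tscale c (pure n m) = pure (c *: n) m.
Proof. by rewrite /tscale tlift_pure //; exact: tscale_bal. Qed.

Lemma tscaleDr : right_distributive tscale +%R.
Proof. by move=> c; apply: tliftD; exact: tscale_bal. Qed.

Lemma tscaleA a b v : tscale a (tscale b v) = tscale (a * b) v.
Proof.
apply: (tensor_ext (f := tscale a \o tscale b)) => [x y|x y|n m] /=.
- by rewrite !tscaleDr.
- by rewrite !tscaleDr.
- by rewrite !tscaleE scalerA.
Qed.

Lemma tscale1 : left_id 1 tscale.
Proof.
by apply: tensor_ext => [x y|//|n m]; rewrite ?tscaleDr ?tscaleE ?scale1r.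
Qed.

Lemma tscaleDl v : {morph tscale^~ v : a b / a + b}.
Proof.
move=> a b; apply: (tensor_ext (g := fun v => tscale a v + tscale b v)).
- by move=> x y; rewrite tscaleDr.
- by move=> x y; rewrite !tscaleDr addrACA.
- by move=> n m; rewrite !tscaleE scalerDl pureDl.
Qed.

HB.instance Definition _ := GRing.Zmodule_isLmodule.Build k tensor
  tscaleA tscale1 tscaleDr tscaleDl.

Lemma pureZl c n m : pure (c *: n) m = c *: pure n m.
Proof. by rewrite [RHS]tscaleE. Qed.

Lemma pure_linl m : linear (pure^~ m).
Proof. by move=> c n n'; rewrite pureDl pureZl. Qed.

Lemma pure_linr n : linear (pure n).
Proof. by move=> c m m'; rewrite pureDr -pureZr pureZl. Qed.

Lemma tlift_linear (W : lmodType k) (f : N -> M -> W) :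
  balanced f -> (forall m, linear (f^~ m)) -> linear (tlift f).
Proof.
move=> fb fl c x y; rewrite (tliftD fb); congr (_ + _).
apply: (tensor_ext (f := fun x => tlift f (c *: x))
                   (g := fun x => c *: tlift f x)) => {x y} [x y|x y|n m].
- by rewrite scalerDr tliftD.
- by rewrite tliftD // scalerDr.
- by rewrite -pureZl !tlift_pure // (linZ _ _ (fl m)).
Qed.

End TensorType.

End Super.

Section TensorBimod.
Variables (k : fieldType) (A B C : superalg k).

Section Actions.
Variables (N : bimod C B) (M : bimod B A).

Definition tpart (p : bool) : tensor N M -> tensor N M :=
  tlift (fun n m => pure (bm_gr N p n) (bm_gr M false m)
                    + pure (bm_gr N (~~ p) n) (bm_gr M true m)).

Lemma tpart_bal p : balanced (fun n m =>
  pure (bm_gr N p n) (bm_gr M false m)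
  + pure (bm_gr N (~~ p) n) (bm_gr M true m)).
Proof.
split=> *; rewrite ?partD ?pureDl ?pureDr; try by rewrite addrACA.
rewrite !part_ract !part_lact negbK !pureDl !pureDr !pure_bal /=.
by rewrite [X in _ + X]addrC [X in _ = _ + X]addrC addrACA.
Qed.

Lemma tpartE p n m : tpart p (pure n m)
  = pure (bm_gr N p n) (bm_gr M false m)
    + pure (bm_gr N (~~ p) n) (bm_gr M true m).
Proof. by rewrite /tpart tlift_pure //; exact: tpart_bal. Qed.

Lemma tpart_linear p : linear (tpart p).
Proof.
apply: tlift_linear; first exact: tpart_bal.
by move=> m c n n'; rewrite !part_linear !pure_linl scalerDr addrACA.
Qed.

Lemma tpart_sum v : tpart false v + tpart true v = v.
Proof.
apply: (tensor_ext (f := fun v => tpart false v + tpart true v) (g := id)).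
- by move=> x y; rewrite !(linD (tpart_linear _)) addrACA.
- by [].
- move=> n m; rewrite !tpartE /= [X in _ + X]addrC addrACA -!pureDr.
  by rewrite [bm_gr M true m + _]addrC !part_sum -pureDl part_sum.
Qed.

Lemma tpart_part p q v : tpart p (tpart q v) = if p == q then tpart q v else 0.
Proof.
apply: (tensor_ext (f := fun v => tpart p (tpart q v))
                   (g := fun v => if p == q then tpart q v else 0)).
- by move=> x y; rewrite !(linD (tpart_linear _)).
- by move=> x y; rewrite !(linD (tpart_linear _)); case: ifP; rewrite ?addr0.
- move=> n m; rewrite !tpartE (linD (tpart_linear _)) !tpartE !part_part.
  by case: p; case: q => /=; rewrite ?pure0l ?pure0r ?addr0 ?add0r.
Qed.

Definition tensor_gr : grading (tensor N M) :=
  Grading tpart_linear tpart_sum tpart_part.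

Definition tlact (c : C) : tensor N M -> tensor N M :=
  tlift (fun n m => pure (lact c n) m).

Definition tract (t : tensor N M) (a : A) : tensor N M :=
  tlift (fun n m => pure n (ract m a)) t.

Lemma tlact_bal c : balanced (fun n m => pure (N := N) (M := M) (lact c n) m).
Proof.
by split=> *; rewrite ?(linD (lact_linr _)) ?pureDl ?pureDr // -lractA pure_bal.
Qed.

Lemma tract_bal a : balanced (fun n m => pure (N := N) (M := M) n (ract m a)).
Proof.
by split=> *; rewrite ?(linD (ract_linl _)) ?pureDl ?pureDr // lractA pure_bal.
Qed.

Lemma tlactE c n m : tlact c (pure n m) = pure (lact c n) m.
Proof. by rewrite /tlact tlift_pure //; exact: tlact_bal. Qed.

Lemma tractE a n m : tract (pure n m) a = pure n (ract m a).
Proof. by rewrite /tract tlift_pure //; exact: tract_bal. Qed.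

Lemma tlact_linr c : linear (tlact c).
Proof.
apply: tlift_linear; first exact: tlact_bal.
by move=> m a n n'; rewrite !(lact_linr, pure_linl).
Qed.

Lemma tract_linl a : linear (tract^~ a).
Proof.
apply: tlift_linear; first exact: tract_bal.
by move=> m c n n'; rewrite pure_linl.
Qed.

Lemma tlact_linl t : linear (tlact^~ t).
Proof.
move=> c x y; apply: (tensor_ext (g := fun t => c *: tlact x t + tlact y t)).
- exact: linD (tlact_linr _).
- by move=> u v; rewrite !(linD (tlact_linr _)) scalerDr addrACA.
- by move=> n m; rewrite !tlactE !(lact_linl, pure_linl).
Qed.

Lemma tract_linr t : linear (tract t).
Proof.
move=> c x y; apply: (tensor_ext (f := tract^~ (c *: x + y))
                                 (g := fun t => c *: tract t x + tract t y)).
- exact: linD (tract_linl _).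
- by move=> u v; rewrite !(linD (tract_linl _)) scalerDr addrACA.
- by move=> n m; rewrite !tractE !(ract_linr, pure_linr).
Qed.

Lemma tlact1 t : tlact (sa_one C) t = t.
Proof.
apply: (tensor_ext (g := id)) => [||n m]; first exact: linD (tlact_linr _).
- by [].
- by rewrite tlactE lact1.
Qed.

Lemma tract1 t : tract t (sa_one A) = t.
Proof.
apply: (tensor_ext (f := tract^~ _) (g := id)) => [||n m].
- exact: linD (tract_linl _).
- by [].
- by rewrite tractE ract1.
Qed.

Lemma tlactM c c' t : tlact (sa_mul c c') t = tlact c (tlact c' t).
Proof.
apply: (tensor_ext (g := fun t => tlact c (tlact c' t))) => [|x y|n m].
- exact: linD (tlact_linr _).
- by rewrite !(linD (tlact_linr _)).
- by rewrite !tlactE lactM.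
Qed.

Lemma tractM a a' t : tract t (sa_mul a a') = tract (tract t a) a'.
Proof.
apply: (tensor_ext (f := tract^~ _) (g := fun t => tract (tract t a) a')).
- exact: linD (tract_linl _).
- by move=> x y; rewrite !(linD (tract_linl _)).
- by move=> n m; rewrite !tractE ractM.
Qed.

Lemma tlractA c t a : tract (tlact c t) a = tlact c (tract t a).
Proof.
apply: (tensor_ext (f := fun t => tract (tlact c t) a)
                   (g := fun t => tlact c (tract t a))).
- by move=> x y; rewrite (linD (tlact_linr _)) (linD (tract_linl _)).
- by move=> x y; rewrite (linD (tract_linl _)) (linD (tlact_linr _)).
- by move=> n m; rewrite !(tractE, tlactE).
Qed.

Lemma tlact_homog p q c t : homog (sa_gr C) p c -> homog tensor_gr q t ->
  homog tensor_gr (p (+) q) (tlact c t).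
Proof.
move=> hc; rewrite /homog /= => <-.
apply: (tensor_ext (f := fun t => tpart (p (+) q) (tlact c (tpart q t)))
                   (g := fun t => tlact c (tpart q t))).
- by move=> x y; rewrite !(linD (tpart_linear _), linD (tlact_linr _)).
- by move=> x y; rewrite !(linD (tpart_linear _), linD (tlact_linr _)).
move=> n m; rewrite tpartE !(linD (tlact_linr _)) !tlactE.
rewrite !(linD (tpart_linear _)) !tpartE !part_part /= -addbN.
have h r : bm_gr N (p (+) r) (lact c (bm_gr N r n)) = lact c (bm_gr N r n).
  by apply: lact_homog => //; exact: part_homog.
by rewrite !h !pure0r addr0 add0r.
Qed.

Lemma tract_homog p q t a : homog tensor_gr p t -> homog (sa_gr A) q a ->
  homog tensor_gr (p (+) q) (tract t a).
Proof.
rewrite /homog /= => + ha => <-.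
apply: (tensor_ext (f := fun t => tpart (p (+) q) (tract (tpart p t) a))
                   (g := fun t => tract (tpart p t) a)).
- by move=> x y; rewrite !(linD (tpart_linear _), linD (tract_linl _)).
- by move=> x y; rewrite !(linD (tpart_linear _), linD (tract_linl _)).
move=> n m; rewrite tpartE !(linD (tract_linl _)) !tractE.
rewrite !(linD (tpart_linear _)) !tpartE !part_part.
have h r s : bm_gr M s (ract (bm_gr M r m) a)
             = if s == r (+) q then ract (bm_gr M r m) a else 0.
  by apply: homog_part; apply: ract_homog => //; exact: part_homog.
rewrite !h; case: p; case: q {ha h} => /=;
  by rewrite ?pure0l ?pure0r ?add0r ?addr0.
Qed.

Lemma tensor_fg : exists (I : finType) (g : I -> tensor N M), forall t,
  exists s : seq (C * I * A), t = \sum_(x <- s) tract (tlact x.1.1 (g x.1.2)) x.2.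
Proof.
have [I [g hg]] := bm_fg N; have [J [h hh]] := bm_fg M.
pose d := \dim (fullv : {vspace B}).
pose e := vbasis (fullv : {vspace B}).
exists (I * J * 'I_d)%type.
exists (fun x : I * J * 'I_d => pure (ract (g x.1.1) e`_x.2) (h x.1.2)) => t.
pose P (t : tensor N M) := exists s : seq (C * (I * J * 'I_d) * A),
  t = \sum_(x <- s)
    tract (tlact x.1.1 (pure (ract (g x.1.2.1.1) e`_x.1.2.2) (h x.1.2.1.2))) x.2.
have P0 : P 0 by exists [::]; rewrite big_nil.
have PD x y : P x -> P y -> P (x + y).
  by move=> [s ->] [s' ->]; exists (s ++ s'); rewrite big_cat.
apply: (tensor_ind (P := P)) => // n m.
have [s ->] := hg n; have [s' ->] := hh m.
rewrite (lin_sum _ _ (pure_linl _)); elim/big_ind: _ => // -[[c i] b] _ /=.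
rewrite (lin_sum _ _ (pure_linr _)); elim/big_ind: _ => // -[[b' j] a] _ /=.
have -> : pure (ract (lact c (g i)) b) (ract (lact b' (h j)) a)
        = tract (tlact c (pure (g i) (lact (sa_mul b b') (h j)))) a.
  by rewrite tlactE tractE lactM pure_bal !lractA.
rewrite (coord_vbasis (memvf (sa_mul b b'))) (lin_sum _ _ (lact_linl _)).
rewrite (lin_sum _ _ (pure_linr _)) (lin_sum _ _ (tlact_linr _)).
rewrite (lin_sum _ _ (tract_linl _)); elim/big_ind: _ => // l _.
set x := coord _ _ _.
exists [:: (x *: c, (i, j, l), a)]; rewrite big_seq1 /=.
rewrite (linZ _ _ (lact_linl _)) (linZ _ _ (pure_linr _)).
by rewrite (linZ _ _ (tlact_linr _)) (linZ _ _ (tlact_linl _)) pure_bal.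
Qed.

Canonical tensor_bimod : bimod C A :=
  Bimod tlact_linl tlact_linr tlact1 tlactM tract_linl tract_linr tract1
    tractM tlractA tlact_homog tract_homog tensor_fg.

Lemma lact_pure c n m : lact c (pure n m : tensor_bimod) = pure (lact c n) m.
Proof. exact: tlactE. Qed.

Lemma ract_pure a n m : ract (pure n m : tensor_bimod) a = pure n (ract m a).
Proof. exact: tractE. Qed.

End Actions.
End TensorBimod.

Section IdBimod.
Variables (k : fieldType) (A : superalg k).

Lemma id_bimod_fg : exists (I : finType) (g : I -> A), forall m,
  exists s : seq (A * I * A), m = \sum_(x <- s) sa_mul (sa_mul x.1.1 (g x.1.2)) x.2.
Proof.
exists unit, (fun=> sa_one A) => m; exists [:: (m, tt, sa_one A)].
by rewrite big_seq1 /= !sa_mul1r.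
Qed.

Lemma sa_mulA' (b b' m : A) : sa_mul (sa_mul b b') m = sa_mul b (sa_mul b' m).
Proof. by rewrite sa_mulA. Qed.

Lemma sa_mulA'' (b b' m : A) : sa_mul m (sa_mul b b') = sa_mul (sa_mul m b) b'.
Proof. by rewrite sa_mulA. Qed.

Definition id_bimod : bimod A A :=
  @Bimod k A A A (sa_gr A) (@sa_mul k A) (@sa_mul k A) (@sa_mull k A) (@sa_mulr k A)
   (@sa_mul1l k A) sa_mulA' (@sa_mull k A) (@sa_mulr k A) (@sa_mul1r k A)
   sa_mulA'' (fun b m a => sa_mulA' b m a)
   (@sa_mul_homog k A) (@sa_mul_homog k A) id_bimod_fg.

End IdBimod.

Section Cells.
Variable k : fieldType.
Implicit Types A B C D : superalg k.

Definition iw_id A B (M : bimod B A) : intertwiner M M :=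
  @Intertwiner k B A M M id (fun _ _ _ => erefl) (fun _ _ => erefl)
    (fun _ _ => erefl) (fun _ _ h => h).

Lemma iw_comp_linear A B (M N P : bimod B A)
  (g : intertwiner N P) (f : intertwiner M N) : linear (g \o f).
Proof. by move=> c x y /=; rewrite !iw_linear. Qed.

Lemma iw_comp_lact A B (M N P : bimod B A)
  (g : intertwiner N P) (f : intertwiner M N) b m :
  (g \o f) (lact b m) = lact b ((g \o f) m).
Proof. by rewrite /= !iw_lact. Qed.

Lemma iw_comp_ract A B (M N P : bimod B A)
  (g : intertwiner N P) (f : intertwiner M N) m a :
  (g \o f) (ract m a) = ract ((g \o f) m) a.
Proof. by rewrite /= !iw_ract. Qed.

Definition iw_comp A B (M N P : bimod B A)
    (g : intertwiner N P) (f : intertwiner M N) : intertwiner M P :=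
  Intertwiner (iw_comp_linear g f) (iw_comp_lact g f) (iw_comp_ract g f)
    (fun p m h => iw_even g (iw_even f h)).

Section LiftIw.
Variables (A B C : superalg k) (N : bimod C B) (M : bimod B A) (P : bimod C A).
Variable f : N -> M -> P.
Hypothesis fbal : balanced f.
Hypothesis flin : forall m, linear (f^~ m).
Hypothesis flact : forall c n m, f (lact c n) m = lact c (f n m).
Hypothesis fract : forall a n m, f n (ract m a) = ract (f n m) a.
Hypothesis feven : forall p q n m, homog (bm_gr N) p n -> homog (bm_gr M) q m ->
  homog (bm_gr P) (p (+) q) (f n m).

Let T := tensor_bimod N M.

Lemma tlift_lact c (t : T) : tlift f (lact c t) = lact c (tlift f t).
Proof.
apply: (tensor_ext (f := fun t : T => tlift f (lact c t))
                   (g := fun t : T => lact c (tlift f t))) => [x y|x y|n m].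
- by rewrite (linD (lact_linr _)) (tliftD fbal).
- by rewrite (tliftD fbal) (linD (lact_linr _)).
- by rewrite lact_pure !(tlift_pure fbal).
Qed.

Lemma tlift_ract (t : T) a : tlift f (ract t a) = ract (tlift f t) a.
Proof.
apply: (tensor_ext (f := fun t : T => tlift f (ract t a))
                   (g := fun t : T => ract (tlift f t) a)) => [x y|x y|n m].
- by rewrite (linD (ract_linl _)) (tliftD fbal).
- by rewrite (tliftD fbal) (linD (ract_linl _)).
- by rewrite ract_pure !(tlift_pure fbal).
Qed.

Lemma tlift_even p (t : T) : homog (bm_gr T) p t ->
  homog (bm_gr P) p (tlift f t).
Proof.
rewrite /homog /= => <-.
apply: (tensor_ext (f := fun t : T => bm_gr P p (tlift f (tpart p t)))
                   (g := fun t : T => tlift f (tpart p t))) => [x y|x y|n m].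
- by rewrite (linD (tpart_linear _)) (tliftD fbal) partD.
- by rewrite (linD (tpart_linear _)) (tliftD fbal).
rewrite tpartE (tliftD fbal) !(tlift_pure fbal) partD.
have h q r : homog (bm_gr P) (q (+) r) (f (bm_gr N q n) (bm_gr M r m)).
  by apply: feven; exact: part_homog.
by congr (_ + _); [have := h p false | have := h (~~ p) true];
   rewrite ?addbF ?addbT ?negbK.
Qed.

Definition tlift_iw : intertwiner T P :=
  @Intertwiner k C A T P (tlift f) (tlift_linear fbal flin) tlift_lact tlift_ract
    tlift_even.

End LiftIw.

Section HComp.
Variables (A B C : superalg k) (N N' : bimod C B) (M M' : bimod B A).
Variables (g : intertwiner N N') (f : intertwiner M M').

Let h (n : N) (m : M) : tensor_bimod N' M' := pure (g n) (f m).

Fact hcomp_bal : balanced h.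
Proof.
split=> *; rewrite /h ?(linD (iw_linear _)) ?pureDl ?pureDr //.
by rewrite iw_ract iw_lact pure_bal.
Qed.

Fact hcomp_lin m : linear (h^~ m).
Proof. by move=> c x y; rewrite /h iw_linear pure_linl. Qed.

Fact hcomp_lact c n m : h (lact c n) m = lact c (h n m).
Proof. by rewrite /h iw_lact lact_pure. Qed.

Fact hcomp_ract a n m : h n (ract m a) = ract (h n m) a.
Proof. by rewrite /h iw_ract ract_pure. Qed.

Lemma pure_homog (A0 B0 C0 : superalg k) (N0 : bimod C0 B0) (M0 : bimod B0 A0)
  p q (n : N0) (m : M0) : homog (bm_gr N0) p n -> homog (bm_gr M0) q m ->
  homog (bm_gr (tensor_bimod N0 M0)) (p (+) q) (pure n m).
Proof.
move=> hn hm; rewrite /homog /= tpartE !(homog_part _ hn) !(homog_part _ hm).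
by case: p {hn}; case: q {hm} => /=; rewrite ?pure0l ?pure0r ?add0r ?addr0.
Qed.

Fact hcomp_even p q n m : homog (bm_gr N) p n -> homog (bm_gr M) q m ->
  homog (bm_gr (tensor_bimod N' M')) (p (+) q) (h n m).
Proof. by move=> *; apply: pure_homog; exact: iw_even. Qed.

Definition iw_tensor : intertwiner (tensor_bimod N M) (tensor_bimod N' M') :=
  tlift_iw hcomp_bal hcomp_lin hcomp_lact hcomp_ract hcomp_even.

Lemma iw_tensorE n m : iw_tensor (pure n m) = pure (g n) (f m).
Proof. by rewrite /= tlift_pure //; exact: hcomp_bal. Qed.

End HComp.

Section Associator.
Variables (A B C D : superalg k).
Variables (P : bimod D C) (N : bimod C B) (M : bimod B A).

Section Right.
Variable m : M.
Let h (p : P) (n : N) : tensor_bimod P (tensor_bimod N M) := pure p (pure n m).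

Fact assoc1_bal : balanced h.
Proof.
split=> *; rewrite /h ?pureDl ?pureDr // pure_bal; congr (pure _ _).
by rewrite lact_pure.
Qed.

Definition assoc1 : tensor P N -> tensor P (tensor_bimod N M) := tlift h.

Lemma assoc1_linear : linear assoc1.
Proof.
apply: tlift_linear; first exact: assoc1_bal.
by move=> n c x y; rewrite /h pure_linl.
Qed.

Lemma assoc1E p n : assoc1 (pure p n) = pure p (pure n m).
Proof. exact: tlift_pure assoc1_bal _ _. Qed.

End Right.

Let h (t : tensor_bimod P N) (m : M) : tensor_bimod P (tensor_bimod N M) :=
  assoc1 m t.

Fact assoc_bal : balanced h.
Proof.
split=> [t t' m|t m m'|t b m]; rewrite /h.
- exact: linD (assoc1_linear _) _ _.
- apply: (tensor_ext (g := fun t => assoc1 m t + assoc1 m' t)) => [|x y|p n].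
  + exact: linD (assoc1_linear _).
  + by rewrite !(linD (assoc1_linear _)) addrACA.
  + by rewrite !assoc1E !pureDr.
- apply: (tensor_ext (f := fun t : tensor_bimod P N => assoc1 m (ract t b))).
  + by move=> x y; rewrite (linD (ract_linl _)) (linD (assoc1_linear _)).
  + exact: linD (assoc1_linear _).
  + by move=> p n; rewrite ract_pure !assoc1E pure_bal.
Qed.

Fact assoc_lin m : linear (h^~ m).
Proof. exact: assoc1_linear. Qed.

Fact assoc_lact c t m : h (lact c t) m = lact c (h t m).
Proof.
apply: (tensor_ext (f := fun t : tensor_bimod P N => assoc1 m (lact c t))
  (g := fun t : tensor_bimod P N => lact c (h t m))).
- by move=> x y; rewrite (linD (lact_linr _)) (linD (assoc1_linear _)).
- by move=> x y; rewrite /h (linD (assoc1_linear _)) (linD (lact_linr _)).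
- by move=> p n; rewrite /h lact_pure !assoc1E lact_pure.
Qed.

Fact assoc_ract a t m : h t (ract m a) = ract (h t m) a.
Proof.
apply: (tensor_ext (f := fun t : tensor_bimod P N => h t (ract m a))
  (g := fun t : tensor_bimod P N => ract (h t m) a)).
- exact: linD (assoc1_linear _).
- by move=> x y; rewrite /h (linD (assoc1_linear _)) (linD (ract_linl _)).
- by move=> p n; rewrite /h /= !assoc1E ract_pure ract_pure.
Qed.

Fact assoc_even p q t m : homog (bm_gr (tensor_bimod P N)) p t ->
  homog (bm_gr M) q m ->
  homog (bm_gr (tensor_bimod P (tensor_bimod N M))) (p (+) q) (h t m).
Proof.
rewrite {1}/homog /= => <- hm.
apply: (tensor_ext
  (f := fun t => bm_gr (tensor_bimod P (tensor_bimod N M)) (p (+) q)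
                   (assoc1 m (tpart p t)))
  (g := fun t => assoc1 m (tpart p t))).
- by move=> x y; rewrite (linD (tpart_linear _)) (linD (assoc1_linear _)) partD.
- by move=> x y; rewrite (linD (tpart_linear _)) (linD (assoc1_linear _)).
move=> x n; rewrite tpartE (linD (assoc1_linear _)) !assoc1E partD.
have e r s : homog (bm_gr (tensor_bimod P (tensor_bimod N M))) (r (+) (s (+) q))
    (pure (bm_gr P r x) (pure (bm_gr N s n) m)).
  by apply: pure_homog (part_homog _ _ _) _; apply: pure_homog (part_homog _ _ _) hm.
by congr (_ + _); [have := e p false | have := e (~~ p) true];
   rewrite // addbA addbT negbK.
Qed.

Definition iw_assoc : intertwiner (tensor_bimod (tensor_bimod P N) M)
    (tensor_bimod P (tensor_bimod N M)) :=
  tlift_iw assoc_bal assoc_lin assoc_lact assoc_ract assoc_even.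

Lemma iw_assocE p n m : iw_assoc (pure (pure p n) m) = pure p (pure n m).
Proof. by rewrite /= tlift_pure ?/h ?assoc1E //; exact: assoc_bal. Qed.

Section Left.
Variable p : P.
Let g (n : N) (m : M) : tensor_bimod (tensor_bimod P N) M := pure (pure p n) m.

Fact assocV1_bal : balanced g.
Proof.
split=> *; rewrite /g ?pureDl ?pureDr ?pureDl // -pure_bal; congr (pure _ _).
by rewrite ract_pure.
Qed.

Definition assocV1 : tensor N M -> tensor (tensor_bimod P N) M := tlift g.

Lemma assocV1_linear : linear assocV1.
Proof.
apply: tlift_linear; first exact: assocV1_bal.
by move=> m c x y; rewrite /g pure_linr pure_linl.
Qed.

Lemma assocV1E n m : assocV1 (pure n m) = pure (pure p n) m.
Proof. exact: tlift_pure assocV1_bal _ _. Qed.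

End Left.

Let g (p : P) (t : tensor_bimod N M) : tensor_bimod (tensor_bimod P N) M :=
  assocV1 p t.

Fact assocV_lin t : linear (g^~ t).
Proof.
move=> c p p'; rewrite /g.
apply: (tensor_ext (g := fun t => c *: assocV1 p t + assocV1 p' t)).
- exact: linD (assocV1_linear _).
- by move=> x y; rewrite !(linD (assocV1_linear _)) scalerDr addrACA.
- by move=> n m; rewrite !assocV1E !pure_linl.
Qed.

Fact assocV_bal : balanced g.
Proof.
split=> [p p' t|p t t'|p b t]; rewrite /g.
- exact: linD (assocV_lin t) _ _.
- exact: linD (assocV1_linear _) _ _.
- apply: (tensor_ext (g := fun t : tensor_bimod N M => assocV1 p (lact b t))).
  + exact: linD (assocV1_linear _).
  + by move=> x y; rewrite (linD (lact_linr _)) (linD (assocV1_linear _)).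
  + by move=> n m; rewrite lact_pure !assocV1E pure_bal.
Qed.

Fact assocV_lact c p t : g (lact c p) t = lact c (g p t).
Proof.
apply: (tensor_ext (f := g (lact c p))
  (g := fun t : tensor_bimod N M => lact c (g p t))).
- exact: linD (assocV1_linear _).
- by move=> x y; rewrite /g (linD (assocV1_linear _)) (linD (lact_linr _)).
- by move=> n m; rewrite /g /= !assocV1E lact_pure lact_pure.
Qed.

Fact assocV_ract a p t : g p (ract t a) = ract (g p t) a.
Proof.
apply: (tensor_ext (f := fun t : tensor_bimod N M => g p (ract t a))
  (g := fun t : tensor_bimod N M => ract (g p t) a)).
- by move=> x y; rewrite /g (linD (ract_linl _)) (linD (assocV1_linear _)).
- by move=> x y; rewrite /g (linD (assocV1_linear _)) (linD (ract_linl _)).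
- by move=> n m; rewrite /g ract_pure !assocV1E ract_pure.
Qed.

Fact assocV_even q r p t : homog (bm_gr P) q p ->
  homog (bm_gr (tensor_bimod N M)) r t ->
  homog (bm_gr (tensor_bimod (tensor_bimod P N) M)) (q (+) r) (g p t).
Proof.
move=> hp; rewrite {1}/homog /= => <-.
apply: (tensor_ext
  (f := fun t => bm_gr (tensor_bimod (tensor_bimod P N) M) (q (+) r)
                   (assocV1 p (tpart r t)))
  (g := fun t => assocV1 p (tpart r t))).
- by move=> x y; rewrite (linD (tpart_linear _)) (linD (assocV1_linear _)) partD.
- by move=> x y; rewrite (linD (tpart_linear _)) (linD (assocV1_linear _)).
move=> n m; rewrite tpartE (linD (assocV1_linear _)) !assocV1E partD.
have e s u : homog (bm_gr (tensor_bimod (tensor_bimod P N) M)) ((q (+) s) (+) u)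
    (pure (pure p (bm_gr N s n)) (bm_gr M u m)).
  by apply: pure_homog _ (part_homog _ _ _); apply: pure_homog hp (part_homog _ _ _).
by congr (_ + _); [have := e r false | have := e (~~ r) true];
   rewrite -addbA ?addbF ?addbT ?negbK.
Qed.

Definition iw_assocV : intertwiner (tensor_bimod P (tensor_bimod N M))
    (tensor_bimod (tensor_bimod P N) M) :=
  tlift_iw assocV_bal assocV_lin assocV_lact assocV_ract assocV_even.

Lemma iw_assocVE p n m : iw_assocV (pure p (pure n m)) = pure (pure p n) m.
Proof. by rewrite /= tlift_pure ?/g ?assocV1E //; exact: assocV_bal. Qed.

End Associator.

Section Unitors.
Variables (A B : superalg k) (M : bimod B A).

Fact lun_bal : balanced (fun (b : id_bimod B) (m : M) => lact (b : B) m).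
Proof.
split=> *; rewrite ?(linD (lact_linl _)) ?(linD (lact_linr _)) //.
by rewrite /= lactM.
Qed.

Fact lun_lact (c : B) (b : id_bimod B) m :
  lact ((lact c b : id_bimod B) : B) m = lact c (lact (b : B) m) :> M.
Proof. by rewrite /= lactM. Qed.

Fact lun_ract (a : A) (b : id_bimod B) m :
  lact (b : B) (ract m a) = ract (lact (b : B) m) a :> M.
Proof. by rewrite lractA. Qed.

Definition iw_lun : intertwiner (tensor_bimod (id_bimod B) M) M :=
  tlift_iw lun_bal (fun m => lact_linl m) lun_lact lun_ract
    (fun p q b m hb hm => lact_homog hb hm).

Lemma iw_lunE (b : B) m : iw_lun (pure (b : id_bimod B) m) = lact b m.
Proof. by rewrite /= tlift_pure //; exact: lun_bal. Qed.

Let u (m : M) : tensor_bimod (id_bimod B) M := pure (sa_one B : id_bimod B) m.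

Fact lunV_lact b m : u (lact b m) = lact b (u m).
Proof. by rewrite /u -pure_bal lact_pure /= sa_mul1l sa_mul1r. Qed.

Fact lunV_ract m a : u (ract m a) = ract (u m) a.
Proof. by rewrite /u ract_pure. Qed.

Fact lunV_even p m : homog (bm_gr M) p m ->
  homog (bm_gr (tensor_bimod (id_bimod B) M)) p (u m).
Proof.
move=> hm; rewrite -[p]addFb.
exact: (pure_homog (N0 := id_bimod B) (p := false) (sa_one_homog B) hm).
Qed.

Definition iw_lunV : intertwiner M (tensor_bimod (id_bimod B) M) :=
  @Intertwiner k B A M (tensor_bimod (id_bimod B) M) u
    (fun c x y => pure_linr _ c x y) lunV_lact lunV_ract lunV_even.

Fact run_bal : balanced (fun (m : M) (a : id_bimod A) => ract m (a : A)).
Proof.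
split=> *; rewrite ?(linD (ract_linl _)) ?(linD (ract_linr _)) //.
by rewrite /= ractM.
Qed.

Fact run_lact (b : B) (m : M) (a : id_bimod A) :
  ract (lact b m) (a : A) = lact b (ract m (a : A)).
Proof. by rewrite lractA. Qed.

Fact run_ract (a' : A) (m : M) (a : id_bimod A) :
  ract m ((ract a a' : id_bimod A) : A) = ract (ract m (a : A)) a'.
Proof. by rewrite /= ractM. Qed.

Definition iw_run : intertwiner (tensor_bimod M (id_bimod A)) M :=
  tlift_iw run_bal (fun a => ract_linl a) run_lact run_ract
    (fun p q m a hm ha => ract_homog hm ha).

Lemma iw_runE m (a : A) : iw_run (pure m (a : id_bimod A)) = ract m a.
Proof. by rewrite /= tlift_pure //; exact: run_bal. Qed.

Let v (m : M) : tensor_bimod M (id_bimod A) := pure m (sa_one A : id_bimod A).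

Fact runV_lact b m : v (lact b m) = lact b (v m).
Proof. by rewrite /v lact_pure. Qed.

Fact runV_ract m a : v (ract m a) = ract (v m) a.
Proof. by rewrite /v pure_bal ract_pure /= sa_mul1l sa_mul1r. Qed.

Fact runV_even p m : homog (bm_gr M) p m ->
  homog (bm_gr (tensor_bimod M (id_bimod A))) p (v m).
Proof.
move=> hm; rewrite -[p]addbF.
exact: (pure_homog (M0 := id_bimod A) (q := false) hm (sa_one_homog A)).
Qed.

Definition iw_runV : intertwiner M (tensor_bimod M (id_bimod A)) :=
  @Intertwiner k B A M (tensor_bimod M (id_bimod A)) v
    (pure_linl _) runV_lact runV_ract runV_even.

End Unitors.

Lemma iw_tensor_ext A B C (N : bimod C B) (M : bimod B A) (P : bimod C A)
  (f g : intertwiner (tensor_bimod N M) P) :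
  (forall n m, f (pure n m) = g (pure n m)) -> f = g.
Proof.
move=> e; apply: iw_ext; apply: tensor_ext e; exact: linD (iw_linear _).
Qed.

Lemma iw_tensor_ext3l A B C D (P : bimod D C) (N : bimod C B) (M : bimod B A)
  (Q : bimod D A) (f g : intertwiner (tensor_bimod (tensor_bimod P N) M) Q) :
  (forall p n m, f (pure (pure p n) m) = g (pure (pure p n) m)) -> f = g.
Proof.
move=> e; apply: iw_tensor_ext => t m.
apply: (tensor_ext (f := fun t => f (pure t m)) (g := fun t => g (pure t m))).
- by move=> x y; rewrite pureDl (linD (iw_linear _)).
- by move=> x y; rewrite pureDl (linD (iw_linear _)).
- by move=> p n; exact: e.
Qed.

Lemma iw_tensor_ext3r A B C D (P : bimod D C) (N : bimod C B) (M : bimod B A)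
  (Q : bimod D A) (f g : intertwiner (tensor_bimod P (tensor_bimod N M)) Q) :
  (forall p n m, f (pure p (pure n m)) = g (pure p (pure n m))) -> f = g.
Proof.
move=> e; apply: iw_tensor_ext => p t.
apply: (tensor_ext (f := fun t => f (pure p t)) (g := fun t => g (pure p t))).
- by move=> x y; rewrite pureDr (linD (iw_linear _)).
- by move=> x y; rewrite pureDr (linD (iw_linear _)).
- by move=> n m; exact: e.
Qed.

Lemma iw_tensor_ext4 A B C D (E : superalg k) (R : bimod E D) (P : bimod D C)
  (N : bimod C B) (M : bimod B A) (Q : bimod E A)
  (f g : intertwiner (tensor_bimod (tensor_bimod (tensor_bimod R P) N) M) Q) :
  (forall r p n m, f (pure (pure (pure r p) n) m)
                   = g (pure (pure (pure r p) n) m)) -> f = g.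
Proof.
move=> e; apply: iw_tensor_ext3l => t n m.
apply: (tensor_ext (f := fun t => f (pure (pure t n) m))
                   (g := fun t => g (pure (pure t n) m))).
- by move=> x y; rewrite !pureDl (linD (iw_linear _)).
- by move=> x y; rewrite !pureDl (linD (iw_linear _)).
- by move=> r p; exact: e.
Qed.

Lemma iw_compE A B (M N P : bimod B A) (g : intertwiner N P)
  (f : intertwiner M N) m : iw_comp g f m = g (f m).
Proof. by []. Qed.

End Cells.

Definition s2Vect (k : fieldType) : bicategory.
Proof.
refine (@Bicategory (superalg k) (fun A B => bimod B A)
  (fun A B M N => intertwiner M N) (fun A => id_bimod A)
  (fun A B C N M => tensor_bimod N M) (fun A B M => iw_id M)
  (fun A B M N P g f => iw_comp g f)
  (fun A B C N N' M M' g f => iw_tensor g f)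
  (fun A B C D P N M => iw_assoc P N M) (fun A B C D P N M => iw_assocV P N M)
  (fun A B M => iw_lun M) (fun A B M => iw_lunV M)
  (fun A B M => iw_run M) (fun A B M => iw_runV M)
  _ _ _ _ _ _ _ _ _ _ _ _ _ _ _ _).
- by move=> *; exact: iw_ext.
- by move=> *; exact: iw_ext.
- by move=> *; exact: iw_ext.
- by move=> *; apply: iw_tensor_ext => n m; rewrite iw_tensorE.
- by move=> *; apply: iw_tensor_ext => n m; rewrite iw_compE !iw_tensorE.
- by move=> *; apply: iw_tensor_ext3l => p n m;
    rewrite iw_compE iw_assocE iw_assocVE.
- by move=> *; apply: iw_tensor_ext3r => p n m;
    rewrite iw_compE iw_assocVE iw_assocE.
- move=> A B M; apply: iw_tensor_ext => b m.
  by rewrite iw_compE iw_lunE /= -pure_bal /= sa_mul1l.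
- by move=> A B M; apply: iw_ext => m; rewrite iw_compE iw_lunE lact1.
- move=> A B M; apply: iw_tensor_ext => m a.
  by rewrite iw_compE iw_runE /= pure_bal /= sa_mul1r.
- by move=> A B M; apply: iw_ext => m; rewrite iw_compE iw_runE ract1.
- by move=> *; apply: iw_tensor_ext3l => p n m;
    rewrite !iw_compE !(iw_assocE, iw_tensorE).
- by move=> *; apply: iw_tensor_ext => b m;
    rewrite !iw_compE iw_tensorE !iw_lunE iw_lact.
- by move=> *; apply: iw_tensor_ext => m a;
    rewrite !iw_compE iw_tensorE !iw_runE iw_ract.
- by move=> *; apply: iw_tensor_ext3l => n b m;
    rewrite !iw_compE iw_assocE !iw_tensorE iw_lunE iw_runE pure_bal.
- by move=> *; apply: iw_tensor_ext4 => r p n m;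
    rewrite !iw_compE !(iw_assocE, iw_tensorE).
Defined.

Section SmoothMaps.
Variable R : realType.
Local Open Scope classical_set_scope.

(* Meant for open [U] and finite-dimensional [V]. *)
Fixpoint Cr (V W : normedModType R) (r : nat) (U : set V) (f : V -> W) : Prop :=
  if r is r'.+1 then
    (forall x, U x -> differentiable f x) /\
    (forall v, Cr r' U (fun x => 'd f x v))
  else forall x, U x -> {for x, continuous f}.

Definition smooth_on (V W : normedModType R) (U : set V) (f : V -> W) : Prop :=
  forall r, Cr r U f.

Lemma diff_near (V W : normedModType R) (f g : V -> W) (x : V) :
  (\forall y \near x, f y = g y) -> differentiable f x ->
  differentiable g x /\ 'd g x = 'd f x :> (V -> W).
Proof.
move=> fg df; have fgx : f x = g x := nbhs_singleton fg.
have cdf : continuous ('d f x) := diff_continuous df.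
have e : g \o shift x = cst (g x) + 'd f x +o_ 0 id.
  have /eqaddoP h := diff_locally df.
  have fg0 : \forall y \near (0 : V), f (y + x) = g (y + x).
    by move: fg; rewrite (near_shift 0) subr0.
  apply/eqaddoP => eps eps0; apply: filterS2 fg0 (h eps eps0) => y /= fgy.
  by rewrite !fctE /= /shift /= -fgx -fgy.
have dg : 'd g x = 'd f x :> (V -> W) := diff_unique cdf e.
split; last exact: dg.
by apply/diff_locallyP; rewrite dg.
Qed.

Lemma Cr_eq (V W : normedModType R) r (U : set V) (f g : V -> W) :
  open U -> (forall x, U x -> f x = g x) -> Cr r U f -> Cr r U g.
Proof.
move=> oU; elim: r f g => [|r ih] f g fg /=.
  move=> cf x Ux; have cfx : f @ x --> f x := cf x Ux.
  rewrite (fg x Ux) in cfx; apply: cvg_trans cfx; apply: near_eq_cvg.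
  have := open_nbhs_nbhs (conj oU Ux); apply: filterS => y Uy; exact: fg.
have fgx x : U x -> \forall y \near x, f y = g y.
  by move=> Ux; have := open_nbhs_nbhs (conj oU Ux); apply: filterS.
move=> [df dfs]; split=> [x Ux|v].
  by have [] := diff_near (fgx x Ux) (df x Ux).
apply: ih (dfs v) => x Ux.
by have [_ ->] := diff_near (fgx x Ux) (df x Ux).
Qed.

Lemma Cr_succ (V W : normedModType R) r (U : set V) (f : V -> W) :
  Cr r.+1 U f -> Cr r U f.
Proof.
elim: r f => [|r ih] f [df dfs]; first by move=> x /df /differentiable_continuous.
by split=> // v; exact: ih.
Qed.

Lemma Cr_sub (V W : normedModType R) r (U U' : set V) (f : V -> W) :
  U' `<=` U -> Cr r U f -> Cr r U' f.
Proof.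
move=> UU'; elim: r f => [|r ih] f /=; first by move=> h x /UU'; exact: h.
by move=> [df dfs]; split=> [x /UU'|v]; [exact: df | exact: ih].
Qed.

Lemma Cr_local (V W : normedModType R) r (U : set V) (f : V -> W) :
  (forall x, U x -> exists U', [/\ open U', U' x & Cr r U' f]) -> Cr r U f.
Proof.
elim: r f => [|r ih] f h /=.
  by move=> x Ux; have [U' [_ U'x]] := h x Ux; exact.
split=> [x Ux|v]; first by have [U' [_ U'x [/(_ x U'x)]]] := h x Ux.
by apply: ih => x Ux; have [U' [oU' U'x [_ hU']]] := h x Ux;
  exists U'; split; [exact: oU' | exact: U'x | exact: hU'].
Qed.

Lemma Cr_cst (V W : normedModType R) r (U : set V) (c : W) :
  Cr r U (fun=> c).
Proof.
elim: r c => [|r ih] c /=; first by move=> x _; apply: cst_continuous.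
split=> [x _|v]; first exact: differentiable_cst.
rewrite (_ : (fun x => _) = fun=> 0); first exact: ih.
by apply: funext => x; rewrite -[fun=> c]/(cst c) diff_cst.
Qed.

Lemma CrD (V W : normedModType R) r (U : set V) (f g : V -> W) : open U ->
  Cr r U f -> Cr r U g -> Cr r U (fun x => f x + g x).
Proof.
move=> oU; elim: r f g => [|r ih] f g /=.
  by move=> cf cg x Ux; apply: continuousD; [exact: cf | exact: cg].
move=> [df dfs] [dg dgs]; split=> [x Ux|v].
  by apply: differentiableD; [exact: df | exact: dg].
apply: (@Cr_eq _ _ _ _ (fun x => 'd f x v + 'd g x v)) => //; last exact: ih.
by move=> x Ux; have /(congr1 (fun F : V -> W => F v)) := diffD (df x Ux) (dg x Ux).
Qed.

Lemma CrM (V : normedModType R) r (U : set V) (f g : V -> R) : open U ->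
  Cr r U f -> Cr r U g -> Cr r U (fun x => f x * g x).
Proof.
move=> oU; elim: r f g => [|r ih] f g.
  by move=> cf cg x Ux; apply: continuousM; [exact: cf | exact: cg].
move=> Cf Cg; have := Cr_succ Cf; have := Cr_succ Cg => Cg' Cf'.
case: Cf Cg => [df dfs] [dg dgs]; split=> [x Ux|v].
  by apply: differentiableM; [exact: df | exact: dg].
apply: (@Cr_eq _ _ _ _ (fun x => f x * 'd g x v + g x * 'd f x v)) => //.
  by move=> x Ux; have /(congr1 (fun F : V -> R => F v)) := diffM (df x Ux) (dg x Ux).
by apply: CrD => //; apply: ih => //; [exact: dgs | exact: dfs].
Qed.

Lemma CrN (V : normedModType R) r (U : set V) (f : V -> R) : open U ->
  Cr r U f -> Cr r U (fun x => - f x).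
Proof.
move=> oU Cf; rewrite (_ : (fun x => - f x) = fun x => -1 * f x).
  by apply: CrM => //; exact: Cr_cst.
by apply: funext => x; rewrite mulN1r.
Qed.

Lemma CrV (V : normedModType R) r (U : set V) (f : V -> R) : open U ->
  (forall x, U x -> f x != 0) -> Cr r U f -> Cr r U (fun x => (f x)^-1).
Proof.
move=> oU f0; elim: r => [|r ih].
  by move=> cf x Ux; apply: continuousV; [exact: f0 | exact: cf].
move=> Cf; have Cf' := ih (Cr_succ Cf).
case: Cf => [df dfs]; split=> [x Ux|v].
  by apply: differentiableV; [exact: df | exact: f0].
apply: (@Cr_eq _ _ _ _ (fun x => - ((f x)^-1 * (f x)^-1 * 'd f x v))) => //.
  move=> x Ux; have /(congr1 (fun F : V -> R => F v)) e :=
    diffV (df x Ux) (f0 x Ux).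
  by apply: etrans (esym e); rewrite -invfM -expr2 -mulNr.
apply: CrN => //; apply: CrM => //; last exact: dfs.
exact: CrM.
Qed.

Lemma Cr_sum (V : normedModType R) r (U : set V) (I : Type) (s : seq I)
  (F : I -> V -> R) : open U ->
  (forall i, Cr r U (F i)) -> Cr r U (fun x => \sum_(i <- s) F i x).
Proof.
move=> oU CF; elim: s => [|i s ih].
  by apply: (@Cr_eq _ _ _ _ (fun=> 0)) (Cr_cst _ _ _) => // x _; rewrite big_nil.
apply: (@Cr_eq _ _ _ _ (fun x => F i x + \sum_(j <- s) F j x)) => //.
  by move=> x _; rewrite big_cons.
exact: CrD.
Qed.

Lemma Cr_coord (V : normedModType R) n r (U : set V) (h : V -> 'rV[R]_n) i :
  open U -> Cr r U h -> Cr r U (fun x => h x 0 i).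
Proof.
move=> oU; elim: r h => [|r ih] h.
  move=> ch x Ux.
  apply: (@continuous_comp _ _ _ h (fun M : 'rV[R]_n => M 0 i) x (ch x Ux)).
  exact: coord_continuous.
move=> [dh dhs]; split=> [x Ux|v].
  exact: (differentiable_comp (dh x Ux) (differentiable_coord _ _ _)).
apply: (@Cr_eq _ _ _ _ (fun x => 'd h x v 0 i)) => //; last exact: (ih _ (dhs v)).
move=> x Ux.
have /(congr1 (fun F : V -> R => F v)) e :=
  diff_comp (dh x Ux) (differentiable_coord (h x) 0 i).
apply: etrans (esym e) => /=.
pose co (M : 'rV[R]_n) : R^o := M 0 i.
have co_lin : linear co by move=> a M N; rewrite /co !mxE.
pose coL := GRing.isLinear.Build R 'rV[R]_n R^o *:%R co co_lin.
pose coF : {linear 'rV[R]_n -> R^o} := HB.pack co coL.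
have cco : continuous coF by exact: coord_continuous.
by have /(congr1 (fun F : 'rV[R]_n -> R^o => F ('d h x v))) := diff_lin (h x) cco.
Qed.

Lemma Cr_comp n p r (U : set 'rV[R]_n) (U' : set 'rV[R]_p)
  (h : 'rV[R]_n -> 'rV[R]_p) (f : 'rV[R]_p -> R) : open U ->
  (forall x, U x -> U' (h x)) -> Cr r U h -> Cr r U' f ->
  Cr r U (fun x => f (h x)).
Proof.
move=> oU hU; elim: r f => [|r ih] f.
  move=> ch cf x Ux; apply: (@continuous_comp _ _ _ h f x (ch x Ux)).
  by apply: cf; exact: hU.
move=> Ch Cf; have Ch' := Cr_succ Ch.
case: Ch Cf => [dh dhs] [df dfs]; split=> [x Ux|v].
  by apply: differentiable_comp; [exact: dh | exact/df/hU].
apply: (@Cr_eq _ _ _ _ (fun x => \sum_i 'd h x v 0 i * 'd f (h x) (delta_mx 0 i))).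
- by [].
- move=> x Ux; have /(congr1 (fun F : 'rV[R]_n -> R => F v)) e :=
    diff_comp (dh x Ux) (df _ (hU _ Ux)).
  apply: etrans (esym e) => /=.
  rewrite [in RHS](row_sum_delta ('d h x v)) linear_sum /=.
  by apply: eq_bigr => i _; rewrite linearZ.
- apply: Cr_sum => // i; apply: CrM => //; first exact: (Cr_coord i oU (dhs v)).
  exact: (ih _ Ch' (dfs _)).
Qed.

End SmoothMaps.

(* A general field of characteristic zero is not a manifold, so smoothness of
   k-valued maps refers to a diffeology on k for which the field operations are
   smooth: [plot U f] says that [f], restricted to the open set [U], is smooth.
   [real_smooth_field], [complex_smooth_field] and [discrete_smooth_field] are
   the usual structures. *)
Record smooth_field (R : realType) (k : fieldType) := SmoothField {
  plot : forall n, set 'rV[R]_n -> ('rV[R]_n -> k) -> Prop;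
  plot_cst : forall n (U : set 'rV[R]_n) c, open U -> plot U (fun=> c);
  plot_local : forall n (U : set 'rV[R]_n) f, open U ->
    (forall x, U x -> exists U' f',
      [/\ open U', U' x, plot U' f' & forall y, U' y -> f y = f' y]) ->
    plot U f;
  plot_comp : forall n p (U : set 'rV[R]_n) (U' : set 'rV[R]_p) h f,
    open U -> open U' -> smooth_on U h -> (forall x, U x -> U' (h x)) ->
    plot U' f -> plot U (f \o h);
  plotD : forall n (U : set 'rV[R]_n) f g, open U ->
    plot U f -> plot U g -> plot U (fun x => f x + g x);
  plotN : forall n (U : set 'rV[R]_n) f, open U ->
    plot U f -> plot U (fun x => - f x);
  plotM : forall n (U : set 'rV[R]_n) f g, open U ->
    plot U f -> plot U g -> plot U (fun x => f x * g x);
  plotV : forall n (U : set 'rV[R]_n) f, open U ->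
    (forall x, U x -> f x != 0) -> plot U f -> plot U (fun x => (f x)^-1)
}.

Section Instances.
Variable R : realType.
Local Open Scope classical_set_scope.

Lemma smooth_on_local n (U : set 'rV[R]_n) (f : 'rV[R]_n -> R) :
  (forall x, U x -> exists U' f',
    [/\ open U', U' x, smooth_on U' f' & forall y, U' y -> f y = f' y]) ->
  smooth_on U f.
Proof.
move=> h r; apply: Cr_local => x Ux.
have [U' [f' [oU' U'x sf' ff']]] := h x Ux.
exists U'; split=> //; apply: (Cr_eq oU' _ (sf' r)).
by move=> y U'y; rewrite ff'.
Qed.

Lemma smooth_on_comp n p (U : set 'rV[R]_n) (U' : set 'rV[R]_p)
  (h : 'rV[R]_n -> 'rV[R]_p) (f : 'rV[R]_p -> R) :
  open U -> smooth_on U h -> (forall x, U x -> U' (h x)) ->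
  smooth_on U' f -> smooth_on U (fun x => f (h x)).
Proof. by move=> oU sh hU sf r; exact: (Cr_comp oU hU (sh r) (sf r)). Qed.

Definition real_smooth_field : smooth_field R R.
Proof.
refine (@SmoothField R R (fun n U f => smooth_on U f) _ _ _ _ _ _ _).
- by move=> n U c _ r; exact: Cr_cst.
- by move=> n U f _; exact: smooth_on_local.
- by move=> n p U U' h f oU _; exact: smooth_on_comp.
- by move=> n U f g oU sf sg r; exact: CrD.
- by move=> n U f oU sf r; exact: CrN.
- by move=> n U f g oU sf sg r; exact: CrM.
- by move=> n U f oU f0 sf r; exact: CrV.
Defined.

Definition complex_smooth_field : smooth_field R R[i].
Proof.
refine (@SmoothField R R[i] (fun n U f =>
  smooth_on U (fun x => complex.Re (f x)) /\
  smooth_on U (fun x => complex.Im (f x))) _ _ _ _ _ _ _).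
- by move=> n U c _; split=> r; exact: Cr_cst.
- move=> n U f _ h; split; apply: smooth_on_local => x Ux;
    have [U' [f' [oU' U'x [s1 s2] e]]] := h x Ux.
  + by exists U', (fun x => complex.Re (f' x)); split=> // y /e ->.
  + by exists U', (fun x => complex.Im (f' x)); split=> // y /e ->.
- move=> n p U U' h f oU _ sh hU [s1 s2].
  by split; [exact: (smooth_on_comp oU sh hU s1)
            | exact: (smooth_on_comp oU sh hU s2)].
- move=> n U f g oU [f1 f2] [g1 g2]; split=> r.
  + apply: (Cr_eq oU _ (CrD oU (f1 r) (g1 r))).
    by move=> x _; case: (f x); case: (g x).
  + apply: (Cr_eq oU _ (CrD oU (f2 r) (g2 r))).
    by move=> x _; case: (f x); case: (g x).
- move=> n U f oU [f1 f2]; split=> r.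
  + apply: (Cr_eq oU _ (CrN oU (f1 r))); by move=> x _; case: (f x).
  + apply: (Cr_eq oU _ (CrN oU (f2 r))); by move=> x _; case: (f x).
- move=> n U f g oU [f1 f2] [g1 g2]; split=> r.
  + apply: (Cr_eq oU _ (CrD oU (CrM oU (f1 r) (g1 r))
                           (CrN oU (CrM oU (f2 r) (g2 r))))).
    by move=> x _; case: (f x); case: (g x).
  + apply: (Cr_eq oU _ (CrD oU (CrM oU (f1 r) (g2 r)) (CrM oU (f2 r) (g1 r)))).
    by move=> x _; case: (f x); case: (g x).
- move=> n U f oU f0 [f1 f2].
  pose d x := complex.Re (f x) * complex.Re (f x)
              + complex.Im (f x) * complex.Im (f x).
  have d0 x : U x -> d x != 0.
    move=> /f0; apply: contraNneq; rewrite /d -!expr2 => /eqP.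
    rewrite paddr_eq0 ?sqr_ge0 // !sqrf_eq0 => /andP[/eqP r0 /eqP i0].
    by rewrite eq_complex r0 i0 !eqxx.
  have sd r : Cr r U (fun x => (d x)^-1).
    by apply: CrV => //; apply: CrD => //; apply: CrM => //.
  split=> r.
  + apply: (Cr_eq oU _ (CrM oU (f1 r) (sd r))).
    by move=> x _; rewrite /d; case: (f x) => a b /=; rewrite -!expr2.
  + apply: (Cr_eq oU _ (CrN oU (CrM oU (f2 r) (sd r)))).
    by move=> x _; rewrite /d; case: (f x) => a b /=; rewrite -!expr2.
Defined.

Definition loc_cst (T : topologicalType) (k : Type) (U : set T) (f : T -> k) :=
  forall x, U x -> \forall y \near x, f y = f x.

Lemma loc_cst_cst (T : topologicalType) (k : Type) (U : set T) (c : k) :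
  loc_cst U (fun=> c).
Proof. by move=> x _; apply: nearW. Qed.

Lemma loc_cst_local (T : topologicalType) (k : Type) (U : set T) (f : T -> k) :
  (forall x, U x -> exists U' f',
    [/\ open U', U' x, loc_cst U' f' & forall y, U' y -> f y = f' y]) ->
  loc_cst U f.
Proof.
move=> h x Ux; have [U' [f' [oU' U'x f'c e]]] := h x Ux.
rewrite (e x U'x); apply: filterS2 (f'c x U'x) (open_nbhs_nbhs (conj oU' U'x)).
by move=> y <- /e.
Qed.

Lemma loc_cst_comp (T T' : topologicalType) (k : Type) (U : set T) (U' : set T')
  (h : T -> T') (f : T' -> k) : (forall x, U x -> {for x, continuous h}) ->
  (forall x, U x -> U' (h x)) -> loc_cst U' f -> loc_cst U (f \o h).
Proof. by move=> ch hU fc x Ux; exact: (ch x Ux _ (fc _ (hU x Ux))). Qed.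

Lemma loc_cst1 (T : topologicalType) (k : Type) (U : set T) (o : k -> k)
  (f : T -> k) : loc_cst U f -> loc_cst U (fun x => o (f x)).
Proof. by move=> fc x Ux; apply: filterS (fc x Ux) => y ->. Qed.

Lemma loc_cst2 (T : topologicalType) (k : Type) (U : set T) (o : k -> k -> k)
  (f g : T -> k) :
  loc_cst U f -> loc_cst U g -> loc_cst U (fun x => o (f x) (g x)).
Proof.
move=> fc gc x Ux; apply: filterS2 (fc x Ux) (gc x Ux).
by move=> y -> ->.
Qed.

Definition discrete_smooth_field (k : fieldType) : smooth_field R k.
Proof.
refine (@SmoothField R k (fun n U f => loc_cst U f) _ _ _ _ _ _ _).
- by move=> n U c _; exact: loc_cst_cst.
- by move=> n U f _; exact: loc_cst_local.
- by move=> n p U U' h f _ _ sh hU; apply: loc_cst_comp hU; exact: (sh 0%N).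
- by move=> n U f g _; exact: loc_cst2.
- by move=> n U f _; exact: loc_cst1.
- by move=> n U f g _; exact: loc_cst2.
- by move=> n U f _ _; exact: loc_cst1.
Defined.

End Instances.

Section LieGroups.
Local Open Scope classical_set_scope.

(* Second countable Hausdorff manifold of dimension [lg_dim] with a smooth atlas
   of charts [lg_chart i] on [lg_dom i], with inverses [lg_param i]. *)
Record abelian_lie_group (R : realType) := AbelianLieGroup {
  lg_sort :> topologicalZmodType;
  lg_dim : nat;
  lg_idx : Type;
  lg_dom : lg_idx -> set lg_sort;
  lg_chart : lg_idx -> lg_sort -> 'rV[R]_lg_dim;
  lg_param : lg_idx -> 'rV[R]_lg_dim -> lg_sort;
  lg_img := fun i => lg_chart i @` lg_dom i;
  lg_hausdorff : hausdorff_space lg_sort;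
  lg_second_countable : @second_countable lg_sort;
  lg_cover : forall x, exists i, lg_dom i x;
  lg_dom_open : forall i, open (lg_dom i);
  lg_img_open : forall i, open (lg_img i);
  lg_chartK : forall i x, lg_dom i x -> lg_param i (lg_chart i x) = x;
  lg_chart_cont : forall i x, lg_dom i x -> {for x, continuous (lg_chart i)};
  lg_param_cont : forall i y, lg_img i y -> {for y, continuous (lg_param i)};
  lg_transition : forall i j,
    smooth_on (lg_chart i @` (lg_dom i `&` lg_dom j)) (lg_chart j \o lg_param i);
  lg_add_smooth : forall i j l, smooth_on
    [set p : 'rV[R]_lg_dim * 'rV[R]_lg_dim | [/\ lg_img i p.1, lg_img j p.2
      & lg_dom l (lg_param i p.1 + lg_param j p.2)]]
    (fun p => lg_chart l (lg_param i p.1 + lg_param j p.2));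
  lg_opp_smooth : forall i j, smooth_on
    [set y | lg_img i y /\ lg_dom j (- lg_param i y)]
    (fun y => lg_chart j (- lg_param i y))
}.

Definition smooth_map (R : realType) (k : fieldType) (K : smooth_field R k)
    (A : abelian_lie_group R) (f : A -> k) : Prop :=
  forall i : lg_idx A, plot K (lg_img i) (f \o lg_param i).

(* Finite generation as a topological group; a compact Lie group which is
   finitely generated as an abstract group is finite. *)
Definition top_finitely_generated (A : topologicalZmodType) : Prop :=
  exists s : seq A, closure
    [set x : A | exists c : nat -> int, x = \sum_(i < size s) s`_i *~ c i]
    = setT.

End LieGroups.

Section DirectSum.
Variables (k : fieldType) (m : nat).

Let V : vectType k := {ffun 'I_m -> k^o}.

Definition even_part (p : bool) (v : V) : V := if p then 0 else v.

Lemma even_part_linear p : linear (even_part p).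
Proof. by move=> c x y; case: p => //=; rewrite scaler0 addr0. Qed.

Lemma even_part_sum v : even_part false v + even_part true v = v.
Proof. by rewrite /= addr0. Qed.

Lemma even_part_part p q v :
  even_part p (even_part q v) = if p == q then even_part q v else 0.
Proof. by case: p; case: q. Qed.

Definition ksum_gr : grading V :=
  Grading even_part_linear even_part_sum even_part_part.

Definition ksum_mul (x y : V) : V := [ffun i => x i * y i].
Definition ksum_one : V := [ffun => 1].

Definition ksum : superalg k.
Proof.
refine (@SuperAlg k V ksum_gr ksum_one ksum_mul _ _ _ _ _ _ _).
- by move=> x y z; apply/ffunP => i; rewrite !ffunE mulrA.
- by move=> x; apply/ffunP => i; rewrite !ffunE mul1r.
- by move=> x; apply/ffunP => i; rewrite !ffunE mulr1.
- by move=> b c x y; apply/ffunP => i; rewrite !ffunE mulrDl scalerAl.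
- by move=> b c x y; apply/ffunP => i; rewrite !ffunE mulrDr scalerAr.
- by [].
- rewrite /homog => -[] [] x y /= hx hy //; apply/ffunP => i.
  + by rewrite -hx !ffunE mul0r.
  + by rewrite -hy !ffunE mulr0.
Defined.

End DirectSum.

Section Reps.
Variables (R : realType) (k : fieldType) (K : smooth_field R k).
Variables (A : abelian_lie_group R) (m : nat).

Definition pf_loop (F : pseudofunctor (BBA A) (s2Vect k)) :
    bimod (F tt : superalg k) (F tt : superalg k) := pf1 F (id1 (tt : BBA A)).

Definition pf_action (F : pseudofunctor (BBA A) (s2Vect k)) (a : A) :
    intertwiner (pf_loop F) (pf_loop F) :=
  @pf2 (BBA A) (s2Vect k) F tt tt tt tt a.

(* F(id) is finite-dimensional, so smoothness of the map from A to End(F(id)) is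
   smoothness of its matrix coefficients. *)
Definition smooth_pseudofunctor (F : pseudofunctor (BBA A) (s2Vect k)) : Prop :=
  forall (x : pf_loop F) (phi : {scalar pf_loop F}),
  smooth_map K (fun a => phi (pf_action F a x)).

Record rep_on := RepOn {
  rep_pf :> pseudofunctor (BBA A) (s2Vect k);
  rep_smooth : smooth_pseudofunctor rep_pf;
  rep_ob : rep_pf tt = ksum k m
}.

Definition rep_equiv (F G : rep_on) : Prop := internal_equivalence F G.

(* Inversion is smooth on the units of k (plotV), so a map to
   them is smooth iff it is smooth as a map to k. *)
Record unit_hom := UnitHom {
  uh_fun :> A -> {ffun 'I_m -> k};
  uh_unit : forall a i, uh_fun a i != 0;
  uhD : forall a b i, uh_fun (a + b) i = uh_fun a i * uh_fun b i;
  uh_smooth : forall i, smooth_map K (fun a => uh_fun a i)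
}.

Definition perm_equiv (f g : unit_hom) : Prop :=
  exists s : 'S_m, forall a i, g a i = f a (s i).

End Reps.

Definition quotient (T : Type) (E : T -> T -> Prop) : Type :=
  {c : T -> Prop | exists x, c = E x}.

(* Main.v *)
(* The unit constraint identifies F(id) with the identity bimodule of B = F( * ),
   so F(a) becomes multiplication by a central even element pf_char F a of B,
   multiplicative in a.  A strong transformation F -> G is a bimodule M whose
   2-cell is forced by the unit axiom, and its naturality says exactly that
   pf_char G a . x = x . pf_char F a on M.  An invertible k^m-k^m-bimodule
   matches the primitive idempotents of both sides by a permutation, so
   equivalent F and G have characters that agree up to a permutation;
   conversely, a permutation yields an invertible twisted bimodule. *)
From HB Require Import structures.
Require Import Defs.
From mathcomp Require Import all_boot all_order all_algebra.
From mathcomp Require Import perm.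
From mathcomp Require Import all_classical all_reals all_analysis.

Set Implicit Arguments.
Unset Strict Implicit.
Unset Printing Implicit Defensive.

Import Order.TTheory GRing.Theory Num.Theory.
Import numFieldNormedType.Exports.
Local Open Scope ring_scope.

(** * Central characters of pseudofunctors out of [BBA A] *)

Section Loop.
Variables (k : fieldType) (A : zmodType).
Variable F : pseudofunctor (BBA A) (s2Vect k).

Definition base : superalg k := F (tt : BBA A).

Definition loop : bimod base base := @pf1 (BBA A) (s2Vect k) F tt tt tt.

Definition loop_unit : intertwiner (id_bimod base) loop :=
  @pf_unit (BBA A) (s2Vect k) F tt.

Definition loop_unitV : intertwiner loop (id_bimod base) :=
  sval (cid (@pf_unit_inv (BBA A) (s2Vect k) F tt)).

Definition loop_act (a : A) : intertwiner loop loop :=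
  @pf2 (BBA A) (s2Vect k) F tt tt tt tt a.

Definition loop_comp : intertwiner (tensor_bimod loop loop) loop :=
  @pf_comp (BBA A) (s2Vect k) F tt tt tt tt tt.

(** A free generator of [loop] on either side, on which the left and right actions of [base] agree.
    Intertwiners out of [loop] are evaluated on it. *)
Definition vac : loop := loop_unit (sa_one base).

Definition pf_char (a : A) : base := loop_unitV (loop_act a vac).

Lemma loop_unitK : cancel loop_unit loop_unitV.
Proof.
rewrite /loop_unitV; case: cid => /= v [e _] x.
exact: (congr1 (fun f : intertwiner (id_bimod base) (id_bimod base) => f x) e).
Qed.

Lemma loop_unitVK : cancel loop_unitV loop_unit.
Proof.
rewrite /loop_unitV; case: cid => /= v [_ e] x.
exact: (congr1 (fun f : intertwiner loop loop => f x) e).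
Qed.

Lemma loop_unitE b : loop_unit b = lact b vac.
Proof. by rewrite /vac -iw_lact /= sa_mul1r. Qed.

Lemma loop_unitE' b : loop_unit b = ract vac b.
Proof. by rewrite /vac -iw_ract /= sa_mul1l. Qed.

Lemma lact_vac b : lact b vac = ract vac b.
Proof. by rewrite -loop_unitE loop_unitE'. Qed.

Lemma loop_gen (x : loop) : exists b, x = lact b vac.
Proof. by exists (loop_unitV x); rewrite -loop_unitE loop_unitVK. Qed.

Lemma lact_vac_inj : injective (fun b : base => lact b vac).
Proof.
by move=> b b'; rewrite -!loop_unitE; exact: (can_inj loop_unitK).
Qed.

Lemma loop_act_vac a : loop_act a vac = lact (pf_char a) vac.
Proof. by rewrite -loop_unitE loop_unitVK. Qed.

(** Both products are the coordinate of [loop_act a (lact b vac)]: [loop_act a] commutes with the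
    two actions, and [b] can act on [vac] from either side. *)
Lemma pf_char_central a b : sa_mul (pf_char a) b = sa_mul b (pf_char a).
Proof.
apply: lact_vac_inj; rewrite !lactM lact_vac -lractA -loop_act_vac.
by rewrite -iw_ract -lact_vac iw_lact loop_act_vac.
Qed.

Lemma loop_actD a b x : loop_act (a + b) x = loop_act a (loop_act b x).
Proof.
exact: (congr1 (fun f : intertwiner loop loop => f x)
  (@pf_vcomp (BBA A) (s2Vect k) F tt tt tt tt tt a b)).
Qed.

Lemma loop_act0 x : loop_act 0 x = x.
Proof.
exact: (congr1 (fun f : intertwiner loop loop => f x)
  (@pf_id2 (BBA A) (s2Vect k) F tt tt tt)).
Qed.

Lemma pf_char0 : pf_char 0 = sa_one base.
Proof. by rewrite /pf_char loop_act0 /vac loop_unitK. Qed.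

(** Composing the two actions multiplies the characters in reverse order; centrality restores the
    order. *)
Lemma pf_charD a b : pf_char (a + b) = sa_mul (pf_char a) (pf_char b).
Proof.
apply: lact_vac_inj; rewrite -loop_act_vac loop_actD loop_act_vac iw_lact.
by rewrite loop_act_vac -lactM pf_char_central.
Qed.

(** The left unit law leaves no freedom in the composition constraint: under the unit constraint it
    becomes the multiplication of [base]. *)
Lemma loop_compE b y : loop_comp (pure (lact b vac) y) = lact b y.
Proof.
(* The left unitor of [BBA A] is the 2-cell 0, so its image under [F] is [loop_act 0], the
   identity. *)
have h : iw_comp (iw_comp (loop_act 0) loop_comp)
    (iw_tensor loop_unit (iw_id loop)) = iw_lun loop :=
  @pf_lun (BBA A) (s2Vect k) F tt tt tt.
have := congr1 (fun f : intertwiner _ _ => f (pure (b : id_bimod base) y)) h.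
by rewrite !iw_compE iw_tensorE iw_lunE loop_act0 loop_unitE.
Qed.

Lemma loop_comp_vac : loop_comp (pure vac vac) = vac.
Proof. by rewrite -[X in pure X _]lact1 loop_compE lact1. Qed.

End Loop.

(** * Strong transformations as bimodules that intertwine the characters *)

Section StrongTrans.
Variables (k : fieldType) (A : zmodType).
Implicit Types F G H : pseudofunctor (BBA A) (s2Vect k).

Lemma iw_loop_ext G (B : superalg k) (M : bimod (base G) B) (P : bimod (base G) B)
  (f g : intertwiner (tensor_bimod (loop G) M) P) :
  (forall b m, f (pure (lact b (vac G)) m) = g (pure (lact b (vac G)) m)) ->
  f = g.
Proof.
by move=> e; apply: iw_tensor_ext => x m; have [b ->] := loop_gen x.
Qed.

Definition tr_ob F G (s : trans_data F G) : bimod (base G) (base F) :=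
  tr0 s (tt : BBA A).

Definition tr_cell F G (s : trans_data F G) :
    intertwiner (tensor_bimod (loop G) (tr_ob s))
      (tensor_bimod (tr_ob s) (loop F)) :=
  @tr1 (BBA A) (s2Vect k) F G s tt tt tt.

(* The unit axiom determines the component of a strong transformation. *)
Lemma tr_cellE F G (s : trans_data F G) : is_strong s -> forall b m,
  tr_cell s (pure (lact b (vac G)) m) = pure (lact b m) (vac F).
Proof.
move=> hs b m; pose M := tr_ob s.
have h : iw_comp (tr_cell s) (iw_tensor (loop_unit G) (iw_id M))
  = iw_comp (iw_comp (iw_tensor (iw_id M) (loop_unit F)) (iw_runV M)) (iw_lun M)
  := @tr_unit (BBA A) (s2Vect k) F G s hs tt.
have := congr1 (fun f : intertwiner _ _ => f (pure (b : id_bimod (base G)) m)) h.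
rewrite !iw_compE iw_tensorE iw_lunE loop_unitE => ->.
by rewrite [iw_runV _ _]/= iw_tensorE.
Qed.

(** The unit constraint followed by the right unitor identifies the tensor product with [M] and
    sends [pure m (vac F)] back to [m]. *)
Lemma pure_vac_inj F (B : superalg k) (M : bimod B (base F)) :
  injective (fun m : M => pure m (vac F)).
Proof.
move=> m m' e.
have := congr1 (iw_comp (iw_run M) (iw_tensor (iw_id M) (loop_unitV F))) e.
by rewrite !iw_compE !iw_tensorE !loop_unitK !iw_runE !ract1.
Qed.

(** Naturality at [a] is evaluated on [pure (vac G) m]. One side puts [pf_char G a] to the left of
    [m]; on the other, balancing moves [pf_char F a] from [vac F] to the right of [m]. *)
Lemma strong_char F G (s : trans_data F G) : is_strong s ->
  forall a (m : tr_ob s), lact (pf_char G a) m = ract m (pf_char F a).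
Proof.
move=> hs a m; pose M := tr_ob s.
have h : iw_comp (tr_cell s) (iw_tensor (loop_act G a) (iw_id M))
  = iw_comp (iw_tensor (iw_id M) (loop_act F a)) (tr_cell s)
  := @tr_nat (BBA A) (s2Vect k) F G s hs tt tt tt tt a.
have := congr1 (fun f : intertwiner _ _ => f (pure (vac G) m)) h.
rewrite !iw_compE iw_tensorE loop_act_vac (tr_cellE hs) -[vac G]lact1.
rewrite (tr_cellE hs) lact1 iw_tensorE loop_act_vac -pure_bal.
exact: pure_vac_inj.
Qed.

Section OfBimod.
Variables (F G : pseudofunctor (BBA A) (s2Vect k)) (M : bimod (base G) (base F)).

(* The two cells are kept opaque so that [iw_compE] does not unfold them. *)
Lemma bimod_cell_spec :
  {c : intertwiner (tensor_bimod (loop G) M) (tensor_bimod M (loop F))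
  | forall b m, c (pure (lact b (vac G)) m) = pure (lact b m) (vac F)}.
Proof.
exists (iw_comp (iw_comp (iw_tensor (iw_id M) (loop_unit F)) (iw_runV M))
    (iw_comp (iw_lun M) (iw_tensor (loop_unitV G) (iw_id M)))) => b m.
rewrite !iw_compE iw_tensorE -loop_unitE loop_unitK iw_lunE.
by rewrite [iw_runV _ _]/= iw_tensorE.
Qed.

Definition bimod_cell := sval bimod_cell_spec.

Lemma bimod_cellE b m :
  bimod_cell (pure (lact b (vac G)) m) = pure (lact b m) (vac F).
Proof. exact: (svalP bimod_cell_spec). Qed.

Lemma bimod_cellV_spec :
  {c : intertwiner (tensor_bimod M (loop F)) (tensor_bimod (loop G) M)
  | forall m b, c (pure m (lact b (vac F))) = pure (vac G) (ract m b)}.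
Proof.
exists (iw_comp (iw_comp (iw_tensor (loop_unit G) (iw_id M)) (iw_lunV M))
    (iw_comp (iw_run M) (iw_tensor (iw_id M) (loop_unitV F)))) => m b.
rewrite !iw_compE iw_tensorE -loop_unitE loop_unitK iw_runE.
by rewrite [iw_lunV _ _]/= iw_tensorE.
Qed.

Definition bimod_cellV := sval bimod_cellV_spec.

Lemma bimod_cellVE m b :
  bimod_cellV (pure m (lact b (vac F))) = pure (vac G) (ract m b).
Proof. exact: (svalP bimod_cellV_spec). Qed.

Lemma bimod_cellK : iw_comp bimod_cellV bimod_cell = iw_id _.
Proof.
apply: iw_loop_ext => b m; rewrite iw_compE bimod_cellE -[vac F]lact1.
by rewrite bimod_cellVE ract1 -pure_bal lact_vac.
Qed.

Lemma bimod_cellVK : iw_comp bimod_cell bimod_cellV = iw_id _.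
Proof.
apply: iw_tensor_ext => m x; have [b ->] := loop_gen x.
rewrite iw_compE bimod_cellVE -[vac G]lact1 bimod_cellE lact1.
by rewrite pure_bal.
Qed.

Definition bimod_trans : trans_data F G :=
  @TransData (BBA A) (s2Vect k) F G
   (fun a => match a with tt => M end)
   (fun a b f => match a, b, f with tt, tt, tt => bimod_cell end).

Hypothesis charM : forall a (m : M), lact (pf_char G a) m = ract m (pf_char F a).

(** Converse of [strong_char]: [charM] gives naturality, while the other laws come from the cell
    being assembled from unit constraints and unitors. *)
Lemma bimod_trans_strong : is_strong bimod_trans.
Proof.
split.
- case=> [] [] []; exists bimod_cellV.
  by split; [exact: bimod_cellK | exact: bimod_cellVK].
- case=> [] [] [] [] a.
  (* This is the goal with both bicategories unfolded, so that the intertwiners can be evaluated on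
     generators. *)
  suff : iw_comp bimod_cell (iw_tensor (loop_act G a) (iw_id M))
    = iw_comp (iw_tensor (iw_id M) (loop_act F a)) bimod_cell by [].
  apply: iw_loop_ext => b m.
  rewrite !iw_compE iw_tensorE iw_lact loop_act_vac -lactM !bimod_cellE.
  by rewrite lactM charM iw_tensorE loop_act_vac -pure_bal lractA.
- case.
  suff : iw_comp bimod_cell (iw_tensor (loop_unit G) (iw_id M))
    = iw_comp (iw_comp (iw_tensor (iw_id M) (loop_unit F)) (iw_runV M)) (iw_lun M).
    by [].
  apply: iw_tensor_ext => b m.
  rewrite !iw_compE iw_tensorE loop_unitE bimod_cellE iw_lunE.
  by rewrite [iw_runV _ _]/= iw_tensorE.
- case=> [] [] [] [] [].
  suff : iw_comp bimod_cell (iw_tensor (loop_comp G) (iw_id M))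
    = iw_comp (iw_comp (iw_comp (iw_comp (iw_comp
        (iw_tensor (iw_id M) (loop_comp F)) (iw_assoc M (loop F) (loop F)))
        (iw_tensor bimod_cell (iw_id (loop F))))
        (iw_assocV (loop G) M (loop F)))
        (iw_tensor (iw_id (loop G)) bimod_cell))
        (iw_assoc (loop G) (loop G) M).
    by [].
  apply: iw_tensor_ext3l => x y m.
  have [b ->] := loop_gen x; have [b' ->] := loop_gen y.
  (* Each use of the cell carries one generator from the left of [m] to the right; the two copies of
     [vac F] then merge by [loop_comp_vac]. *)
  rewrite !iw_compE iw_tensorE loop_compE -lactM bimod_cellE.
  rewrite iw_assocE iw_tensorE bimod_cellE iw_assocVE iw_tensorE bimod_cellE.
  by rewrite iw_assocE iw_tensorE loop_comp_vac -lactM.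
Qed.

End OfBimod.

(* Naturality of a modification into the identity holds automatically here. *)
Lemma comp_trans_iso F G (s : trans_data F G) (t : trans_data G F)
    (f : intertwiner (tensor_bimod (tr_ob t) (tr_ob s)) (id_bimod (base F)))
    (g : intertwiner (id_bimod (base F)) (tensor_bimod (tr_ob t) (tr_ob s))) :
  is_strong s -> is_strong t ->
  iw_comp g f = iw_id _ -> iw_comp f g = iw_id _ ->
  iso_trans (comp_trans t s) (id_trans F).
Proof.
move=> hs ht gf fg.
pose md a : @cell (s2Vect k) _ _ (tr0 (comp_trans t s) a) (tr0 (id_trans F) a) :=
  match a with tt => f end.
have md_nat (a b : BBA A) (x : Defs.hom a b) :
  vcomp (tr1 (id_trans F) x) (hcomp (id2 (pf1 F x)) (md a))
  = vcomp (hcomp (md b) (id2 (pf1 F x))) (tr1 (comp_trans t s) x).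
  case: a b x => [] [] [].
  suff : iw_comp (iw_comp (iw_lunV (loop F)) (iw_run (loop F)))
      (iw_tensor (iw_id (loop F)) f)
    = iw_comp (iw_tensor f (iw_id (loop F)))
      (iw_comp (iw_comp (iw_comp (iw_comp (iw_assocV (tr_ob t) (tr_ob s) (loop F))
         (iw_tensor (iw_id (tr_ob t)) (tr_cell s)))
         (iw_assoc (tr_ob t) (loop G) (tr_ob s)))
         (iw_tensor (tr_cell t) (iw_id (tr_ob s))))
         (iw_assocV (loop F) (tr_ob t) (tr_ob s))) by [].
  apply: iw_tensor_ext3r => x n m; have [b ->] := loop_gen x.
  rewrite !iw_compE iw_assocVE !iw_tensorE (tr_cellE ht) iw_assocE iw_tensorE.
  rewrite -[vac G]lact1 (tr_cellE hs) lact1 iw_assocVE iw_tensorE iw_runE.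
  rewrite [iw_lunV _ _]/= lractA -lact_vac -lactM.
  rewrite -lact_pure iw_lact; set z := f _.
  by rewrite -pure_bal /= sa_mul1l.
exists (Modification md_nat); case; exists g; split; [exact: gf | exact: fg].
Qed.

End StrongTrans.

(** * Algebra isomorphisms and their twisted bimodules *)

Section AlgIso.
Variable k : fieldType.

Record alg_iso (B B' : superalg k) := AlgIso {
  ai_fun :> B -> B';
  ai_inv : B' -> B;
  ai_linear : linear ai_fun;
  aiM : {morph ai_fun : x y / sa_mul x y};
  ai1 : ai_fun (sa_one B) = sa_one B';
  ai_part : forall p b, ai_fun (sa_gr B p b) = sa_gr B' p (ai_fun b);
  aiK : cancel ai_fun ai_inv;
  aiVK : cancel ai_inv ai_fun
}.

Definition ai_sym (B B' : superalg k) (f : alg_iso B B') : alg_iso B' B.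
Proof.
refine (@AlgIso B' B (ai_inv f) f _ _ _ _ (aiVK f) (aiK f)).
- by move=> c x y; apply: (can_inj (aiK f)); rewrite ai_linear !aiVK.
- by move=> x y; apply: (can_inj (aiK f)); rewrite aiM !aiVK.
- by apply: (can_inj (aiK f)); rewrite ai1 aiVK.
- by move=> p b; apply: (can_inj (aiK f)); rewrite ai_part !aiVK.
Defined.

Definition ai_trans (B B' B'' : superalg k) (f : alg_iso B B')
  (g : alg_iso B' B'') : alg_iso B B''.
Proof.
refine (@AlgIso B B'' (g \o f) (ai_inv f \o ai_inv g) _ _ _ _ _ _).
- by move=> c x y /=; rewrite !ai_linear.
- by move=> x y /=; rewrite !aiM.
- by rewrite /= !ai1.
- by move=> p b /=; rewrite !ai_part.
- by move=> x /=; rewrite !aiK.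
- by move=> x /=; rewrite !aiVK.
Defined.

(** The value of a representation is only propositionally equal to [ksum k m]; using the equality as
    an isomorphism avoids transporting elements and bimodules along it. *)
Definition ai_eq (B B' : superalg k) (e : B = B') : alg_iso B B' :=
  match e with
  | erefl => @AlgIso B B id id (fun _ _ _ => erefl) (fun _ _ => erefl) erefl
      (fun _ _ => erefl) (fun _ => erefl) (fun _ => erefl)
  end.

Lemma ai_homog (B B' : superalg k) (f : alg_iso B B') p b :
  homog (sa_gr B) p b -> homog (sa_gr B') p (f b).
Proof. by rewrite /homog -ai_part => ->. Qed.

Section Twist.
Variables (B B' : superalg k) (f : alg_iso B' B).

Lemma twist_fg : exists (I : finType) (g : I -> B), forall m,
  exists s : seq (B' * I * B),
    m = \sum_(x <- s) sa_mul (sa_mul (f x.1.1) (g x.1.2)) x.2.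
Proof.
exists unit, (fun=> sa_one B) => m; exists [:: (sa_one B', tt, m)].
by rewrite big_seq1 /= ai1 !sa_mul1l.
Qed.

(** The regular bimodule of [B] with its left action restricted along [f]; its inverse is the twist
    along the inverse isomorphism. *)
Definition twist : bimod B' B.
Proof.
refine (@Bimod k B' B B (sa_gr B) (fun b x => sa_mul (f b) x) (@sa_mul k B)
  _ _ _ _ (@sa_mull k B) (@sa_mulr k B) (@sa_mul1r k B) _ _ _
  (@sa_mul_homog k B) twist_fg).
- by move=> m c x y; rewrite ai_linear sa_mull.
- by move=> b; exact: sa_mulr.
- by move=> m; rewrite ai1 sa_mul1l.
- by move=> b b' m; rewrite aiM sa_mulA.
- by move=> a a' m; rewrite sa_mulA.
- by move=> b m a; rewrite sa_mulA.
- by move=> p q b m hb hm; apply: sa_mul_homog hm; exact: ai_homog.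
Defined.

End Twist.

Section TwistInverse.
Variables (B B' : superalg k) (f : alg_iso B' B) (g : alg_iso B B').
Hypotheses (fK : cancel f g) (gK : cancel g f).

Let T := tensor_bimod (twist g) (twist f).
Let ev (n : twist g) (x : twist f) : id_bimod B := sa_mul (f n) (x : B).

Fact twist_ev_bal : balanced ev.
Proof.
split=> [n n' x|n x x'|n b x]; rewrite /ev.
- by rewrite (linD (ai_linear f)) (linD (sa_mull _)).
- by rewrite (linD (sa_mulr _)).
- by rewrite /= aiM sa_mulA.
Qed.

Fact twist_ev_lin x : linear (ev^~ x).
Proof. by move=> c n n'; rewrite /ev ai_linear sa_mull. Qed.

Fact twist_ev_lact b n x : ev (lact b n) x = lact b (ev n x).
Proof. by rewrite /ev /= aiM gK sa_mulA. Qed.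

Fact twist_ev_ract b n x : ev n (ract x b) = ract (ev n x) b.
Proof. by rewrite /ev /= sa_mulA. Qed.

Fact twist_ev_even p q n x : homog (bm_gr (twist g)) p n ->
  homog (bm_gr (twist f)) q x -> homog (bm_gr (id_bimod B)) (p (+) q) (ev n x).
Proof. by move=> hn hx; apply: sa_mul_homog hx; exact: ai_homog. Qed.

Definition twist_ev : intertwiner T (id_bimod B) :=
  tlift_iw twist_ev_bal twist_ev_lin twist_ev_lact twist_ev_ract twist_ev_even.

Lemma twist_evE n x : twist_ev (pure n x) = sa_mul (f n) (x : B).
Proof. exact: tlift_pure twist_ev_bal _ _. Qed.

Let co (x : id_bimod B) : T := pure (sa_one B' : twist g) (x : twist f).

Fact twist_co_lact b x : co (lact b x) = lact b (co x).
Proof.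
rewrite /co lact_pure.
have -> : lact b (sa_one B' : twist g) = ract (sa_one B' : twist g) (g b).
  by rewrite /= sa_mul1l sa_mul1r.
by rewrite pure_bal /= gK.
Qed.

Fact twist_co_ract x b : co (ract x b) = ract (co x) b.
Proof. by rewrite /co ract_pure. Qed.

Fact twist_co_even p x : homog (bm_gr (id_bimod B)) p x ->
  homog (bm_gr T) p (co x).
Proof.
move=> hx; rewrite -[p]addFb.
exact: (pure_homog (N0 := twist g) (M0 := twist f) (p := false)
          (sa_one_homog B') hx).
Qed.

Fact twist_co_linear : linear co.
Proof.
exact: (pure_linr (N := twist g) (M := twist f) (sa_one B' : twist g)).
Qed.

Definition twist_co : intertwiner (id_bimod B) T :=
  @Intertwiner k B B (id_bimod B) T co twist_co_linear
    twist_co_lact twist_co_ract twist_co_even.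

(** In [twist g] one has [n = ract 1 n], so balancing rewrites [pure n x] as [pure 1 (f n * x)],
    which is [co] of the evaluation. *)
Lemma twist_evK : iw_comp twist_co twist_ev = iw_id _.
Proof.
apply: iw_tensor_ext => n x; rewrite iw_compE twist_evE /= /co.
have -> : sa_mul (f n) (x : B) = lact (n : B') x by [].
by rewrite -pure_bal /= sa_mul1l.
Qed.

Lemma twist_coK : iw_comp twist_ev twist_co = iw_id _.
Proof.
by apply: iw_ext => x; rewrite iw_compE [twist_co _]/= /co twist_evE ai1 sa_mul1l.
Qed.

End TwistInverse.

(** Matching characters are central, so the twists along [f] and its inverse satisfy the condition
    of [bimod_trans_strong]. The two composites are the same computation with [f] and [g]
    exchanged. *)
Lemma iso_internal_equivalence (A : zmodType)
    (F G : pseudofunctor (BBA A) (s2Vect k)) (f : alg_iso (base G) (base F)) :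
  (forall a, f (pf_char G a) = pf_char F a) -> internal_equivalence F G.
Proof.
move=> fchar; pose g := ai_sym f.
have fK : cancel f g by exact: aiK.
have gK : cancel g f by exact: aiVK.
have hs : is_strong (bimod_trans (twist f)).
  by apply: bimod_trans_strong => a m; rewrite /= fchar pf_char_central.
have ht : is_strong (bimod_trans (twist g)).
  by apply: bimod_trans_strong => a m; rewrite /= -fchar aiK pf_char_central.
exists (bimod_trans (twist f)), (bimod_trans (twist g)); split=> //.
- exact: (comp_trans_iso hs ht (twist_evK gK) (twist_coK gK)).
- exact: (comp_trans_iso ht hs (twist_evK fK) (twist_coK fK)).
Qed.

End AlgIso.

(** * The algebra of m copies of k and its invertible bimodules *)

Section KSum.
Variables (k : fieldType) (m : nat).
Local Notation K := (ksum k m).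

Definition kcoord (z : K) (i : 'I_m) : k := (z : {ffun 'I_m -> k^o}) i.
(** The primitive idempotents, written e_j below. *)
Definition kdelta (i : 'I_m) : K := [ffun j => (i == j)%:R] : {ffun 'I_m -> k^o}.

Lemma kcoordM z w i : kcoord (sa_mul z w) i = kcoord z i * kcoord w i.
Proof. by rewrite /kcoord /= ffunE. Qed.

Lemma kcoord_linear i : linear (kcoord^~ i : K -> k^o).
Proof. by move=> c x y; rewrite /kcoord !ffunE. Qed.

Lemma kcoordD z w i : kcoord (z + w) i = kcoord z i + kcoord w i.
Proof. exact: linD (kcoord_linear i) z w. Qed.

Lemma kcoord0 i : kcoord 0 i = 0.
Proof. exact: lin0 (kcoord_linear i). Qed.

Lemma kcoordZ c z i : kcoord (c *: z) i = c * kcoord z i.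
Proof. exact: linZ _ _ (kcoord_linear i). Qed.

Lemma kcoord_sum (I : Type) (s : seq I) (z : I -> K) i :
  kcoord (\sum_(x <- s) z x) i = \sum_(x <- s) kcoord (z x) i.
Proof. exact: lin_sum s z (kcoord_linear i). Qed.

Lemma kcoord1 i : kcoord (sa_one K) i = 1.
Proof. by rewrite /kcoord /= ffunE. Qed.

Lemma kcoord_delta i j : kcoord (kdelta i) j = (i == j)%:R.
Proof. by rewrite /kcoord ffunE. Qed.

Lemma kcoord_ext z w : kcoord z =1 kcoord w -> z = w.
Proof. by move=> e; apply/ffunP. Qed.

Lemma kdelta_mulr z i : sa_mul z (kdelta i) = kcoord z i *: kdelta i.
Proof.
apply: kcoord_ext => j; rewrite kcoordM kcoordZ kcoord_delta.
by case: eqP => [->|]; rewrite ?mulr0.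
Qed.

Lemma kdelta_mull z i : sa_mul (kdelta i) z = kcoord z i *: kdelta i.
Proof.
by rewrite -kdelta_mulr; apply: kcoord_ext => j; rewrite !kcoordM mulrC.
Qed.

Lemma kdelta_sum : sa_one K = \sum_i kdelta i.
Proof.
apply: kcoord_ext => j; rewrite kcoord1 kcoord_sum (bigD1 j) //= kcoord_delta.
rewrite eqxx big1 ?addr0 // => i /negPf ij.
by rewrite kcoord_delta ij.
Qed.

Lemma ksum_decomp z : z = \sum_i kcoord z i *: kdelta i.
Proof.
rewrite -[LHS](sa_mul1r (s := K)) kdelta_sum (lin_sum _ _ (sa_mulr _)).
by apply: eq_bigr => i _; rewrite kdelta_mulr.
Qed.

(* For each i some h_i(p e_j, q) is nonzero, where h_i(x, y) is the i-th
   coordinate of al(x (x) y).  Such j are distinct for i <> i': the product of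
   the functionals h_i(- e_j, q) and h_i'(p', e_j -) shows that
   e_i p (x) q' e_i' is nonzero, whereas al maps it into e_i k^m e_i' = 0. *)
Lemma invertible_bimod_perm (M N : bimod K K)
    (al : intertwiner (tensor_bimod M N) (id_bimod K))
    (be : intertwiner (id_bimod K) (tensor_bimod M N)) :
  iw_comp be al = iw_id _ -> iw_comp al be = iw_id _ ->
  exists s : 'S_m, forall z z' : K,
    (forall x : M, lact z' x = ract x z) ->
    forall i, kcoord z' i = kcoord z (s i).
Proof.
move=> ba ab.
pose h i (x : M) (y : N) : k := kcoord (al (pure x y)) i.
have hDl i x x' y : h i (x + x') y = h i x y + h i x' y.
  by rewrite /h pureDl (linD (iw_linear _)) kcoordD.
have hDr i x y y' : h i x (y + y') = h i x y + h i x y'.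
  by rewrite /h pureDr (linD (iw_linear _)) kcoordD.
have hZl i c x y : h i (c *: x) y = c * h i x y.
  by rewrite /h pureZl (linZ _ _ (iw_linear _)) kcoordZ.
have hZr i c x y : h i x (c *: y) = c * h i x y.
  by rewrite -hZl /h pureZr.
have hlact i b x y : h i (lact b x) y = kcoord b i * h i x y.
  by rewrite /h -lact_pure iw_lact /= kcoordM.
have hract i b x y : h i x (ract y b) = h i x y * kcoord b i.
  by rewrite /h -ract_pure iw_ract /= kcoordM.
have hbal i b x y : h i (ract x b) y = h i x (lact b y).
  by rewrite /h pure_bal.
have ex i : exists j, exists x : M, exists y : N, h i (ract x (kdelta j)) y != 0.
  (* Otherwise, since the e_j sum to 1, the i-th coordinate of [al] vanishes identically, although
     [al] composed with [be] fixes the unit. *)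
  apply: contrapT => nex.
  have h0 t : kcoord (al t) i = 0.
    move: t; apply: tensor_ind => [|x y ex ey|x y].
    - by rewrite (lin0 (iw_linear al)) kcoord0.
    - by rewrite (linD (iw_linear al)) kcoordD ex ey addr0.
    rewrite -[X in pure X _]ract1 kdelta_sum (lin_sum _ _ (ract_linr _)).
    rewrite (lin_sum _ _ (pure_linl _)) (lin_sum _ _ (iw_linear al)) kcoord_sum.
    apply: big1 => j _; apply/eqP; apply: contrapT => hn.
    by apply: nex; exists j, x, y; apply/negP.
  have := congr1 (fun f : intertwiner (id_bimod K) (id_bimod K) =>
    kcoord (f (sa_one K)) i) ab.
  by rewrite iw_compE h0 kcoord1 => /esym /eqP; rewrite oner_eq0.
have [s hs] := choice ex.
have s_inj : injective s.
  move=> i i' e; apply: contrapT => /eqP ii'.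
  have [p [q pq]] := hs i; have [p' [q' pq']] := hs i'.
  rewrite -e in pq'; set j := s i in pq pq'.
  pose g (x : M) (y : N) : k :=
    h i (ract x (kdelta j)) q * h i' p' (lact (kdelta j) y).
  have gbal : balanced g.
    split=> *; rewrite /g.
    - by rewrite (linD (ract_linl _)) hDl mulrDl.
    - by rewrite (linD (lact_linr _)) hDr mulrDr.
    (* Next to e_j the element [b] acts by the scalar [kcoord b j] on either side; hence this
       product of two separate functionals is balanced. *)
    - rewrite -ractM -lactM kdelta_mulr kdelta_mull.
      rewrite (linZ _ _ (ract_linr _)) (linZ _ _ (lact_linl _)) hZl hZr.
      by rewrite mulrCA mulrA.
  have z0 : pure (lact (kdelta i) p) (ract q' (kdelta i')) = 0 :> tensor_bimod M N.
    have baE t : be (al t) = t :=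
      congr1 (fun f : intertwiner (tensor_bimod M N) (tensor_bimod M N) => f t) ba.
    rewrite -[LHS]baE -lact_pure -ract_pure iw_lact iw_ract.
    have -> : lact (kdelta i) (ract (al (pure p q')) (kdelta i')) = 0.
      apply: kcoord_ext => l; rewrite [LHS]kcoordM.
      rewrite [kcoord (@ract _ _ _ (id_bimod K) _ _) l]kcoordM.
      rewrite !kcoord_delta kcoord0; case: eqP => [<-|_]; last by rewrite mul0r.
      by rewrite eq_sym (negPf ii') !mulr0.
    exact: lin0 (iw_linear be).
  have g0 : tlift g 0 = 0.
    by apply: (addrI (tlift g 0)); rewrite -(tliftD gbal) !addr0.
  have := congr1 (tlift g) z0; rewrite g0 tlift_pure // /g.
  rewrite lractA hlact -lractA hract -hbal !kcoord_delta !eqxx mul1r mulr1.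
  by move=> /eqP; rewrite mulf_eq0 (negPf pq) (negPf pq').
exists (perm s_inj) => z z' zz' i; rewrite permE.
(* On p e_j with j = s i, the left action of [z'] contributes [kcoord z' i] to [h i] and the right
   action of [z] contributes [kcoord z j]; the nonzero value of [h i] cancels. *)
have [p [q /mulIf]] := hs i; apply.
rewrite -hlact zz' -ractM kdelta_mull (linZ _ _ (ract_linr _)) hZl.
by [].
Qed.

Definition perm_iso (s : 'S_m) : alg_iso K K.
Proof.
refine (@AlgIso k K K (fun z => [ffun i => kcoord z (s i)] : {ffun 'I_m -> k^o})
  (fun z => [ffun i => kcoord z (s^-1%g i)] : {ffun 'I_m -> k^o}) _ _ _ _ _ _).
- by move=> c x y; apply: kcoord_ext => i; rewrite /kcoord !ffunE.
- by move=> x y; apply: kcoord_ext => i; rewrite /kcoord /= !ffunE.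
- by apply: kcoord_ext => i; rewrite /kcoord /= !ffunE.
- by case=> b; apply: kcoord_ext => i; rewrite /kcoord /= !ffunE.
- by move=> x; apply: kcoord_ext => i; rewrite /kcoord /= !ffunE permKV.
- by move=> x; apply: kcoord_ext => i; rewrite /kcoord /= !ffunE permK.
Defined.

Lemma perm_isoE s z i : kcoord (perm_iso s z) i = kcoord z (s i).
Proof. by rewrite /kcoord ffunE. Qed.

(** Stated for variable algebras so that both equalities can be eliminated; it applies to the values
    of two representations through [rep_ob]. *)
Lemma invertible_bimod_perm_eq (B B' : superalg k) (e : B = K) (e' : B' = K)
    (M : bimod B' B) (N : bimod B B')
    (al : intertwiner (tensor_bimod M N) (id_bimod B'))
    (be : intertwiner (id_bimod B') (tensor_bimod M N)) :
  iw_comp be al = iw_id _ -> iw_comp al be = iw_id _ ->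
  exists s : 'S_m, forall (z : B) (z' : B'),
    (forall x : M, lact z' x = ract x z) ->
    forall i, kcoord (ai_eq e' z') i = kcoord (ai_eq e z) (s i).
Proof. by subst B B'; exact: invertible_bimod_perm. Qed.

End KSum.

(** * Representations and their homomorphisms to the units *)

Section Reps.
Variables (R : realType) (k : fieldType) (S : smooth_field R k).
Variables (A : abelian_lie_group R) (m : nat).
Local Notation K := (ksum k m).

Definition rep_char (F : rep_on S A m) (a : A) (i : 'I_m) : k :=
  kcoord (ai_eq (rep_ob F) (pf_char F a)) i.

Lemma rep_charD F a b i : rep_char F (a + b) i = rep_char F a i * rep_char F b i.
Proof. by rewrite /rep_char pf_charD aiM kcoordM. Qed.

Lemma rep_char0 F i : rep_char F 0 i = 1.
Proof. by rewrite /rep_char pf_char0 ai1 kcoord1. Qed.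

(** The value at [- a] is an inverse. *)
Lemma rep_char_neq0 F a i : rep_char F a i != 0.
Proof.
apply/eqP => a0; have := rep_charD F a (- a) i.
by rewrite subrr rep_char0 a0 mul0r => /eqP; rewrite oner_eq0.
Qed.

(** A coordinate of the character is a linear functional of the action on [vac F], hence one of the
    matrix coefficients assumed smooth. *)
Lemma rep_char_smooth F i : smooth_map S (fun a => rep_char F a i).
Proof.
pose phi (x : loop F) : k := kcoord (ai_eq (rep_ob F) (loop_unitV F x)) i.
have phi_lin : linear_for *%R phi.
  move=> c x y; rewrite /phi (iw_linear (loop_unitV F)).
  by rewrite (ai_linear (ai_eq (rep_ob F))) kcoordD kcoordZ.
pose phiM := GRing.isLinear.Build k (loop F) k *%R phi phi_lin.
pose phiF : {scalar loop F} := HB.pack phi phiM.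
exact: (rep_smooth (r := F) (vac F) phiF).
Qed.

Definition rep_unit_hom (F : rep_on S A m) : unit_hom S A m.
Proof.
refine (@UnitHom R k S A m (fun a => [ffun i => rep_char F a i]) _ _ _).
- by move=> a i; rewrite ffunE; exact: rep_char_neq0.
- by move=> a b i; rewrite !ffunE; exact: rep_charD.
- move=> i; have := @rep_char_smooth F i.
  by congr smooth_map; apply/funext => a; rewrite ffunE.
Defined.

Section OfUnitHom.
Variable u : unit_hom S A m.

Definition uh_elt (a : A) : K := [ffun i => uh_fun u a i] : {ffun 'I_m -> k^o}.

Lemma kcoord_uh a i : kcoord (uh_elt a) i = uh_fun u a i.
Proof. by rewrite /kcoord ffunE. Qed.

Lemma uh_eltD a b : uh_elt (a + b) = sa_mul (uh_elt a) (uh_elt b).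
Proof. by apply: kcoord_ext => i; rewrite kcoordM !kcoord_uh uhD. Qed.

Lemma uh_elt0 : uh_elt 0 = sa_one K.
Proof.
apply: kcoord_ext => i; rewrite kcoord_uh kcoord1.
apply: (mulfI (uh_unit u 0 i)).
by rewrite -uhD addr0 mulr1.
Qed.

Lemma ksum_mulC (x y : K) : sa_mul x y = sa_mul y x.
Proof. by apply: kcoord_ext => i; rewrite !kcoordM mulrC. Qed.

Definition mul_iw (z : K) : intertwiner (id_bimod K) (id_bimod K).
Proof.
refine (@Intertwiner k K K (id_bimod K) (id_bimod K) (sa_mul z) _ _ _ _).
- exact: sa_mulr.
- move=> b x; rewrite -[LHS]/(sa_mul z (sa_mul b x)).
  by rewrite -[RHS]/(sa_mul b (sa_mul z x)) !sa_mulA [sa_mul z b]ksum_mulC.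
- by move=> x b; exact: sa_mulA.
- by move=> p x hx; rewrite -[p]addFb; apply: sa_mul_homog hx.
Defined.

Lemma mul_iwE z x : mul_iw z x = sa_mul z x. Proof. by []. Qed.

Lemma mul_iw0 : mul_iw (uh_elt 0) = iw_id (id_bimod K).
Proof. by apply: iw_ext => x; rewrite mul_iwE uh_elt0 sa_mul1l. Qed.

(** With the identity bimodule as loop, the composition constraint is multiplication, and the
    coherence laws become identities in a commutative algebra. *)
Definition uh_pf : pseudofunctor (BBA A) (s2Vect k).
Proof.
refine (@Pseudofunctor (BBA A) (s2Vect k) (fun=> K) (fun _ _ _ => id_bimod K)
  (fun _ _ _ _ a => mul_iw (uh_elt a)) (fun=> iw_id (id_bimod K))
  (fun _ _ _ _ _ => iw_lun (id_bimod K)) _ _ _ _ _ _ _ _).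
- by move=> ?; exists (iw_id (id_bimod K)); split; exact: iw_ext.
- move=> ? ? ? ? ?; exists (iw_lunV (id_bimod K)).
  by split; [exact: (@lunK (s2Vect k)) | exact: (@lunVK (s2Vect k))].
- by move=> ? ? ?; exact: mul_iw0.
- move=> ? ? ? ? ? a b; apply: iw_ext => x.
  by rewrite [RHS]iw_compE !mul_iwE uh_eltD sa_mulA.
(* Horizontal composition in [BBA A] is also addition, so the claim is (u_a x)(u_b y) = u_(a+b) (x
   y), which needs commutativity. *)
- move=> ? ? ? ? ? ? ? a b; apply: iw_tensor_ext => x y.
  rewrite [LHS]iw_compE [RHS]iw_compE iw_tensorE !iw_lunE !mul_iwE.
  rewrite -[lact _ _]/(sa_mul (sa_mul (uh_elt a) x) (sa_mul (uh_elt b) y)).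
  rewrite -[lact _ _]/(sa_mul x y).
  by apply: kcoord_ext => i; rewrite uh_eltD !kcoordM mulrACA.
- move=> ? ? ? ? ? ? ?; apply: iw_tensor_ext3l => x y z.
  pose I := id_bimod K.
  suff : iw_comp (iw_comp (mul_iw (uh_elt 0)) (iw_lun I))
      (iw_tensor (iw_lun I) (iw_id I)) (pure (pure x y) z)
    = iw_comp (iw_comp (iw_lun I) (iw_tensor (iw_id I) (iw_lun I)))
      (iw_assoc I I I) (pure (pure x y) z) by [].
  rewrite mul_iw0 !iw_compE iw_assocE !iw_tensorE !iw_lunE.
  exact: esym (sa_mulA _ _ _).
- move=> ? ? ?; apply: iw_tensor_ext => x y.
  pose I := id_bimod K.
  suff : iw_comp (iw_comp (mul_iw (uh_elt 0)) (iw_lun I))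
      (iw_tensor (iw_id I) (iw_id I)) (pure x y) = iw_lun I (pure x y) by [].
  by rewrite mul_iw0 !iw_compE !iw_tensorE.
- move=> ? ? ?; apply: iw_tensor_ext => x y.
  pose I := id_bimod K.
  suff : iw_comp (iw_comp (mul_iw (uh_elt 0)) (iw_lun I))
      (iw_tensor (iw_id I) (iw_id I)) (pure x y) = iw_run I (pure x y) by [].
  by rewrite mul_iw0 !iw_compE !iw_tensorE iw_lunE iw_runE.
Defined.

Lemma pf_char_uh_pf a : pf_char uh_pf a = uh_elt a.
Proof.
(* The inverse [loop_unitV] is a chosen one and does not compute; after comparison on [vac], which
   is the unit here, both sides are convertible. *)
apply: (@lact_vac_inj _ _ uh_pf); rewrite -loop_act_vac.
by [].
Qed.

End OfUnitHom.

Lemma plot_sum n (U : set 'rV[R]_n) (I : Type) (s : seq I) (f : I -> 'rV[R]_n -> k) :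
  open U -> (forall i, plot S U (f i)) -> plot S U (fun x => \sum_(i <- s) f i x).
Proof.
move=> oU pf; elim: s => [|i s ih].
  rewrite (_ : (fun x => _) = fun=> 0); first exact: plot_cst.
  by apply/funext => x; rewrite big_nil.
rewrite (_ : (fun x => _) = fun x => f i x + \sum_(j <- s) f j x).
  exact: plotD.
by apply/funext => x; rewrite big_cons.
Qed.

(** Expanding in the idempotents writes each matrix coefficient as a combination of the components
    of [u] with constant coefficients. *)
Lemma uh_pf_smooth (u : unit_hom S A m) : smooth_pseudofunctor S (uh_pf u).
Proof.
move=> x phi i.
rewrite (_ : _ \o _ = fun y => \sum_j
    uh_fun u (lg_param i y) j * (kcoord x j * phi (kdelta k j))).
  apply: plot_sum => [|j]; first exact: lg_img_open.
  apply: plotM; [exact: lg_img_open | exact: uh_smooth | ].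
  by apply: plot_cst; exact: lg_img_open.
apply/funext => y; set z := uh_elt u (lg_param i y).
rewrite -[LHS]/(phi (sa_mul z x)) (ksum_decomp (sa_mul z x)).
rewrite (linear_sum phi); apply: eq_bigr => j _.
by rewrite (linearZ_LR phi) kcoordM kcoord_uh /= mulrA.
Qed.

Definition uh_rep (u : unit_hom S A m) : rep_on S A m :=
  @RepOn R k S A m (uh_pf u) (@uh_pf_smooth u) erefl.

Lemma rep_char_uh u a i : rep_char (uh_rep u) a i = uh_fun u a i.
Proof. by rewrite /rep_char /= pf_char_uh_pf kcoord_uh. Qed.

Lemma rep_equivP (F G : rep_on S A m) :
  rep_equiv F G <-> perm_equiv (rep_unit_hom F) (rep_unit_hom G).
Proof.
split=> [[s [t [hs ht _ [md mdK]]]]|[s hs]].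
  (* In the composite of [s] after [t] the bimodule of [s], on which [strong_char] compares the
     characters, is the left tensor factor. *)
  have [be [ba ab]] := mdK tt.
  have [sg hsg] := invertible_bimod_perm_eq (rep_ob F) (rep_ob G) ba ab.
  exists sg => a i; rewrite !ffunE; apply: hsg => x.
  exact: strong_char hs a x.
(* The hypothesis reads G_i = F_(s i), so passing from the character of [G] to that of [F] takes the
   inverse permutation. *)
pose f := ai_trans (ai_trans (ai_eq (rep_ob G)) (perm_iso k s^-1%g))
  (ai_sym (ai_eq (rep_ob F))).
apply: (iso_internal_equivalence (f := f)) => a.
apply: (can_inj (aiK (ai_eq (rep_ob F)))); rewrite /= aiVK.
apply: kcoord_ext => i; rewrite -[LHS]/(kcoord (perm_iso k s^-1%g _) i) perm_isoE.
by have := hs a (s^-1%g i); rewrite !ffunE permKV.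
Qed.

End Reps.

(** * Passage to equivalence classes *)

Lemma quotient_bijection (T T' : Type) (E : T -> T -> Prop)
    (E' : T' -> T' -> Prop) (h : T -> T') :
  (forall x y, E x y <-> E' (h x) (h y)) ->
  (forall x, E' x x) -> (forall x y, E' x y -> E' y x) ->
  (forall x y z, E' x y -> E' y z -> E' x z) ->
  (forall y, exists x, E' (h x) y) ->
  exists f : quotient E -> quotient E', bijective f.
Proof.
move=> hE E'refl E'sym E'trans hsurj.
have E'eq x y : E' x y -> E' x = E' y.
  move=> xy; apply/funext => z; apply/propext.
  by split; [apply: E'trans (E'sym _ _ xy) | apply: E'trans xy].
have Eh x : E x = (fun y => E' (h x) (h y)).
  by apply/funext => y; apply/propext.
have f_class (c : quotient E) :
    exists y, (fun y => exists2 x, sval c x & E' (h x) y) = E' y.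
  case: c => c [x cx] /=; rewrite cx; exists (h x).
  apply/funext => y; apply/propext.
  split=> [[z /hE xz]|xy]; first exact: E'trans.
  by exists x => //; apply/hE.
have g_class (d : quotient E') : exists x, (fun x => sval d (h x)) = E x.
  case: d => d [y dy] /=; rewrite dy; have [x xy] := hsurj y.
  by exists x; rewrite Eh (E'eq _ _ xy).
(* Classes are predicates: [f] saturates the image under [h] and [g] takes the preimage, so neither
   map chooses representatives. *)
pose f c : quotient E' := exist (fun p => exists y, p = E' y) _ (f_class c).
pose g d : quotient E := exist (fun p => exists x, p = E x) _ (g_class d).
exists f, g.
- case=> c [x cx]; apply: eq_exist; apply/funext => y; apply/propext => /=.
  rewrite cx; split=> [[z /hE xz zy]|/hE xy].
    by apply/hE; exact: E'trans zy.
  by exists x => //; apply/hE.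
- case=> d [y dy]; apply: eq_exist; apply/funext => z; apply/propext => /=.
  rewrite dy; split=> [[x]|yz]; first exact: E'trans.
  by have [x xz] := hsurj z; exists x => //; exact: E'trans (E'sym _ _ xz).
Qed.

Theorem proposition7p16 (R : realType)
  (k : fieldType) (char0 : [pchar k] =i pred0) (K : smooth_field R k)
  (A : abelian_lie_group R)
  (Acompact : compact [set: A]%classic)
  (Afg : top_finitely_generated A)
  (m : nat) (m_gt0 : (0 < m)%N) :
  exists f : quotient (@rep_equiv R k K A m) ->
             quotient (@perm_equiv R k K A m),
    bijective f.
Proof.
apply: (quotient_bijection (h := @rep_unit_hom R k K A m)).
- exact: rep_equivP.
- by move=> u; exists 1%g => a i; rewrite perm1.
- move=> u v [s uv]; exists s^-1%g => a i; by rewrite uv permKV.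
(* Products of permutations apply the left factor first, and w_i = v_(t i) = u_(s (t i)). *)
- move=> u v w [s uv] [t vw]; exists (t * s)%g => a i.
  by rewrite vw uv permM.
(* The character of [uh_rep u] is [u] itself, so the identity permutation suffices. *)
- move=> u; exists (uh_rep u), 1%g => a i.
  by rewrite perm1 ffunE rep_char_uh.
Qed.
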